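(* Let $\mathcal{F}\subseteq\mathcal{L}$ be a class of formulae such that satisfiability testing for (finite) $S\subseteq\mathcal{F}$ takes polynomial time in the size of $S$. Let $\mathcal{C}$ be a class of default theories $\langle D,W\rangle$ such that $D=\{:\phi/\phi\mid\phi\in F\}$ for some finite set $F\subseteq\mathcal{F}$ and $W\subseteq\mathcal{F}$ is finite. Then for $\Delta=\langle D,W\rangle\in\mathcal{C}$, $\phi\in\mathcal{F}$, and strict total orders $\mathcal{P}$ on $D$, the problem of testing $\Delta\models^L_{\mathcal{P}}\neg\phi$ is solvable in polynomial time in the size of $D\cup W\cup\{\neg\phi\}$.
   Context: $\mathcal{L}$ is the set of formulae of classical propositional logic, $\models$ classical logical consequence, and $Cn(S)=\{\phi\in\mathcal{L}\mid S\models\phi\}$ for $S\subseteq\mathcal{L}$. A default is a rule $\alpha{:}\beta_1,\ldots,\beta_n/\gamma$ with $\alpha,\beta_1,\ldots,\beta_n,\gamma\in\mathcal{L}$ (prerequisite $\alpha$, justifications $\beta_j$, conclusion $\gamma$); $:\phi/\phi$ denotes $\top{:}\phi/\phi$ with $\top$ a valid formula. A default theory is a pair $\langle D,W\rangle$ with $D$ a set of defaults and $W\subseteq\mathcal{L}$. (Reiter) extensions: for $S\subseteq\mathcal{L}$ let $\Gamma(S)$ be the smallest set such that $W\subseteq\Gamma(S)$, $Cn(\Gamma(S))=\Gamma(S)$, and whenever $\alpha{:}\beta_1,\ldots,\beta_n/\gamma\in D$, $\alpha\in\Gamma(S)$ and $\{\neg\beta_1,\ldots,\neg\beta_n\}\cap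 S=\emptyset$, then $\gamma\in\Gamma(S)$. $E\subseteq\mathcal{L}$ is an extension of $\langle D,W\rangle$ iff $\Gamma(E)=E$. A default $\alpha{:}\beta_1,\ldots,\beta_n/\gamma$ is applied in $E$, written $\mathrm{appl}(\delta,E)$ for this default $\delta$, if $E\models\alpha$ and $\{\neg\beta_1,\ldots,\neg\beta_n\}\cap Cn(E)=\emptyset$. $\mathrm{appl}(\delta,E,E')$ abbreviates ''$\mathrm{appl}(\delta,E)$ and not $\mathrm{appl}(\delta,E')$''. Let $\mathcal{P}$ be a strict partial order (transitive, asymmetric) on $D$; $\delta\mathcal{P}\delta'$ means $\delta$ has higher priority. An extension $E$ of $\Delta=\langle D,W\rangle$ is a $\mathcal{P}$-preferred$^L$ extension of $\Delta$ if there is a strict total order $\mathcal{T}$ on $D$ such that $\mathcal{P}\subseteq\mathcal{T}$ and for all extensions $E'$ of $\Delta$ and all $\delta\in D$: $\mathrm{appl}(\delta,E',E)$ implies that for some $\epsilon\in D$, $\epsilon\mathcal{T}\delta$ and $\mathrm{appl}(\epsilon,E,E')$. $\Delta\models^L_{\mathcal{P}}\psi$ means that $\psi$ belongs to all $\mathcal{P}$-preferred$^L$ extensions of $\Delta$. *)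

(* Defs.v *)
From HB Require Import structures.
From mathcomp Require Import all_boot all_algebra.
From mathcomp Require Import boolp classical_sets cardinality.

Set Implicit Arguments.
Unset Strict Implicit.
Unset Printing Implicit Defensive.

Local Open Scope classical_set_scope.

(* Propositional variables are named by words over {0,1}. *)
Definition atom := bitseq.

Inductive formula : Type :=
| Var of atom
| Top
| Bot
| Neg of formula
| And of formula & formula
| Or of formula & formula
| Imp of formula & formula
| Iff of formula & formula.

Lemma atom_eq_dec (a b : atom) : {a = b} + {a <> b}.
Proof. exact: (eq_comparable a b). Defined.

Lemma formula_eq_dec (f g : formula) : {f = g} + {f <> g}.
Proof. decide equality; exact: atom_eq_dec. Defined.

HB.instance Definition _ := hasDecEq.Build formula (compareP formula_eq_dec).

Fixpoint eval (v : atom -> bool) (f : formula) : bool :=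
  match f with
  | Var a => v a
  | Top => true
  | Bot => false
  | Neg g => ~~ eval v g
  | And g h => eval v g && eval v h
  | Or g h => eval v g || eval v h
  | Imp g h => eval v g ==> eval v h
  | Iff g h => eval v g == eval v h
  end.

Definition model (v : atom -> bool) (S : set formula) : Prop :=
  forall f, S f -> eval v f.

Definition satisfiable (S : set formula) : Prop := exists v, model v S.

Definition entails (S : set formula) (f : formula) : Prop :=
  forall v, model v S -> eval v f.

Definition Cn (S : set formula) : set formula := [set f | entails S f].

Record default : Type := Default {
  prerequisite : formula;
  justifications : seq formula;
  conclusion : formula }.

Lemma default_eq_dec (d e : default) : {d = e} + {d <> e}.
Proof.
by decide equality; try exact: formula_eq_dec; exact: (eq_comparable _ _).
Defined.

HB.instance Definition _ := hasDecEq.Build default (compareP default_eq_dec).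

(* The default [: f / f]. *)
Definition normal_default (f : formula) : default := Default Top [:: f] f.

Definition negated_justifications (d : default) : set formula :=
  [set Neg b | b in [set` justifications d]].

Record default_theory : Type := DefaultTheory {
  defaults : set default;
  facts : set formula }.

Definition Gamma_closed (D : set default) (S G : set formula) : Prop :=
  Cn G = G /\
  forall d, D d -> G (prerequisite d) ->
    negated_justifications d `&` S = set0 -> G (conclusion d).

(* [smallest C W] is the intersection of all the supersets of [W] satisfying
   [C]; as [Gamma_closed D S] is stable under intersection, [Gamma Delta S]
   is the least such set. *)
Definition Gamma (Delta : default_theory) (S : set formula) : set formula :=
  smallest (Gamma_closed (defaults Delta) S) (facts Delta).

Definition extension (Delta : default_theory) (E : set formula) : Prop :=
  Gamma Delta E = E.

Definition appl (d : default) (E : set formula) : Prop :=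
  entails E (prerequisite d) /\ negated_justifications d `&` Cn E = set0.

Definition appl_diff (d : default) (E E' : set formula) : Prop :=
  appl d E /\ ~ appl d E'.

Definition strict_partial_order_on {T : Type} (D : set T) (P : T -> T -> Prop)
    : Prop :=
  [/\ forall x y, P x y -> D x /\ D y,
      forall x y z, P x y -> P y z -> P x z &
      forall x y, P x y -> ~ P y x].

Definition strict_total_order_on {T : Type} (D : set T) (P : T -> T -> Prop)
    : Prop :=
  strict_partial_order_on D P /\
  forall x y, D x -> D y -> x <> y -> P x y \/ P y x.

Definition preferred_L (Delta : default_theory) (P : default -> default -> Prop)
    (E : set formula) : Prop :=
  extension Delta E /\
  exists T : default -> default -> Prop,
    [/\ strict_total_order_on (defaults Delta) T,
        forall d e, P d e -> T d e &
        forall E', extension Delta E' ->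
        forall d, defaults Delta d -> appl_diff d E' E ->
        exists e, [/\ defaults Delta e, T e d & appl_diff e E E']].

Definition entails_L (Delta : default_theory) (P : default -> default -> Prop)
    (f : formula) : Prop :=
  forall E, preferred_L Delta P E -> E f.

Inductive move := MoveLeft | Stay | MoveRight.

(* Cells contain [option G], with [None] for the blank. The first component
   lists the cells to the left of the head (nearest first), the second one the
   cells from the head rightwards; all other cells of the two-way infinite tape
   are blank. *)
Definition tape (G : Type) : Type := (seq (option G) * seq (option G))%type.

Definition tape_read {G : Type} (t : tape G) : option G := head None t.2.

Definition tape_write_move {G : Type} (a : option G * move) (t : tape G)
    : tape G :=
  match a.2 with
  | MoveLeft => (behead t.1, head None t.1 :: a.1 :: behead t.2)
  | Stay => (t.1, a.1 :: behead t.2)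
  | MoveRight => (a.1 :: t.1, behead t.2)
  end.

(* [tm_answer q] is [None] when [q] is not a halting state, [Some true] when it
   is accepting and [Some false] when it is rejecting. *)
Record turing_machine (I : Type) : Type := TuringMachine {
  tm_tapes : nat;
  tm_symbol : finType;
  tm_input : I -> tm_symbol;
  tm_state : finType;
  tm_start : tm_state;
  tm_answer : tm_state -> option bool;
  tm_delta : tm_state -> {ffun 'I_tm_tapes.+1 -> option tm_symbol} ->
    tm_state * {ffun 'I_tm_tapes.+1 -> option tm_symbol * move} }.

Section TuringMachine.
Variables (I : Type) (M : turing_machine I).

Definition tm_config : Type :=
  (tm_state M * {ffun 'I_(tm_tapes M).+1 -> tape (tm_symbol M)})%type.

Definition tm_step (c : tm_config) : tm_config :=
  if tm_answer c.1 is Some _ then c else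
  let a := tm_delta c.1 [ffun i => tape_read (c.2 i)] in
  (a.1, [ffun i => tape_write_move (a.2 i) (c.2 i)]).

Definition tm_init (w : seq I) : tm_config :=
  (tm_start M,
   [ffun i => if i == ord0 then ([::], [seq Some (tm_input M x) | x <- w])
              else ([::], [::])]).

Definition tm_halts_within (w : seq I) (t : nat) (b : bool) : Prop :=
  exists2 n, n <= t & tm_answer (iter n tm_step (tm_init w)).1 = Some b.

End TuringMachine.

(* The instances are the elements of [A]; nothing is required of the machine
   on other inputs (membership in [A] need not be decidable). *)
Definition poly_time_decidable {I X : Type} (enc : X -> seq I)
    (size_of : X -> nat) (A Q : set X) : Prop :=
  exists (M : turing_machine I) (p : {poly nat}), forall x, A x ->
    exists2 b : bool, tm_halts_within M (enc x) p.[size_of x]%R b & (b <-> Q x).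

Inductive symbol : Type :=
| sVar | sBit of bool | sEnd
| sTop | sBot | sNeg | sAnd | sOr | sImp | sIff
| sColon | sComma | sSlash
| sHigher
| sSep | sBar.

(* Polish notation *)
Fixpoint enc_formula (f : formula) : seq symbol :=
  match f with
  | Var a => sVar :: rcons (map sBit a) sEnd
  | Top => [:: sTop]
  | Bot => [:: sBot]
  | Neg g => sNeg :: enc_formula g
  | And g h => sAnd :: enc_formula g ++ enc_formula h
  | Or g h => sOr :: enc_formula g ++ enc_formula h
  | Imp g h => sImp :: enc_formula g ++ enc_formula h
  | Iff g h => sIff :: enc_formula g ++ enc_formula h
  end.

Definition enc_default (d : default) : seq symbol :=
  enc_formula (prerequisite d) ++ sColon ::
  flatten [seq rcons (enc_formula b) sComma | b <- justifications d] ++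
  sSlash :: enc_formula (conclusion d).

Definition enc_pair (de : default * default) : seq symbol :=
  enc_default de.1 ++ sHigher :: enc_default de.2.

Definition enc_list {T : Type} (enc : T -> seq symbol) (s : seq T)
    : seq symbol :=
  flatten [seq rcons (enc x) sSep | x <- s].

(* The size of the finite set [[set` s]]: repetitions in [s] do not count. *)
Definition set_size {T : eqType} (enc : T -> seq symbol) (s : seq T) : nat :=
  \sum_(x <- undup s) size (enc x).

(* A finite set is presented by listing its elements in an arbitrary order,
   without repetition. *)

Definition poly_time_satisfiability (F : set formula) : Prop :=
  poly_time_decidable (enc_list enc_formula) (set_size enc_formula)
    [set S : seq formula | uniq S /\ [set` S] `<=` F]
    [set S : seq formula | satisfiable [set` S]].

Record instance : Type := Instance {
  inst_defaults : seq default;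
  inst_facts : seq formula;
  inst_order : seq (default * default);
  inst_query : formula }.

Definition inst_theory (x : instance) : default_theory :=
  DefaultTheory [set` inst_defaults x] [set` inst_facts x].

Definition inst_rel (x : instance) (d e : default) : Prop :=
  (d, e) \in inst_order x.

Definition enc_instance (x : instance) : seq symbol :=
  enc_list enc_default (inst_defaults x) ++ sBar ::
  enc_list enc_formula (inst_facts x) ++ sBar ::
  enc_list enc_pair (inst_order x) ++ sBar ::
  enc_formula (Neg (inst_query x)).

(* The size of D `|` W `|` {~ phi}; the priority order is part of the input
   but its length is not counted. *)
Definition inst_size (x : instance) : nat :=
  set_size enc_default (inst_defaults x) +
  set_size enc_formula (Neg (inst_query x) :: inst_facts x).

Definition poly_time_preferred_L (F : set formula) (C : set default_theory)
    : Prop :=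
  poly_time_decidable enc_instance inst_size
    [set x | [/\ uniq (inst_defaults x), uniq (inst_facts x) &
                 uniq (inst_order x)] /\
             [/\ C (inst_theory x),
                 strict_total_order_on [set` inst_defaults x] (inst_rel x) &
                 F (inst_query x)]]
    [set x | entails_L (inst_theory x) (inst_rel x) (Neg (inst_query x))].

(* Main.v *)
(* Write [fs] for the set of formulas [f] with [: f / f] in [D].  Run through
   [fs] from the highest priority to the lowest and accept a formula whenever it
   is consistent with [W] and the formulas accepted so far; let [acc] be the
   result.  Then Cn (W u acc) is the only preferred extension: a rejected formula
   is inconsistent with [W] and accepted formulas of higher priority, so an
   extension applying it fails to apply one of these; conversely, two preferred
   extensions cannot differ, by induction along the (total) priority order.
   Hence the answer is yes iff W u acc u {phi} is unsatisfiable, and |D| + 1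
   calls of the satisfiability test suffice.

   For the time bound this algorithm is run on a Turing machine.  Structured
   programs over finitely many stacks are compiled to machines with one tape
   per stack; each tape of the given satisfiability machine is simulated by two
   stacks.  To examine formulas in the order of priority without sorting, keep
   the multiset of the second components of the pairs in the order: in each pass,
   every pending formula that still occurs in it gives up one occurrence and is
   deferred, so that a formula is processed in the pass numbered by its rank.
   The satisfiability machine is only reliable on lists without repetition, so a
   formula is removed from the current list before it is added. *)

(* The rank of a formula is the number of pairs having it as second component. Since the order is
   transitive and listed without repetition, this counts its predecessors, so ranks increase
   strictly along the order, and by totality a formula whose occurrences are used up comes after
   everything accepted so far. A formula already in the current list is accepted without a test, as
   the set does not change. If [W] is unsatisfiable, a formula of [W] may thus be accepted, so
   consistency of the result is claimed only for satisfiable [W]; otherwise the set of all formulas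
   is the only extension. The list of pairs is not counted in the size, but without repetition it
   has at most quadratically many entries of linear length, so the input is polynomially long.
   Running times are bounds in one number [N] above all code lengths; only the last list, which also
   receives the query, may be longer, whence the factor 2. *)
From HB Require Import structures.
Require Import Defs.
From mathcomp Require Import all_boot all_algebra.
From mathcomp Require Import boolp classical_sets cardinality.
From mathcomp Require Import zify.

Set Implicit Arguments.
Unset Strict Implicit.
Unset Printing Implicit Defensive.

Local Open Scope classical_set_scope.

(** * Preferred extensions *)

Lemma normal_default_inj : injective normal_default.
Proof. by move=> f g []. Qed.

Section Logic.
Implicit Types (S : set formula) (f g phi : formula) (W fs acc : seq formula).

Lemma entails_mono S S' f : S `<=` S' -> entails S f -> entails S' f.
Proof. by move=> sub H v mv; apply: H => g /sub; apply: mv. Qed.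

Lemma satisfiable_mono S S' : S `<=` S' -> satisfiable S' -> satisfiable S.
Proof. by move=> sub [v mv]; exists v => g /sub; apply: mv. Qed.

Lemma sub_Cn S : S `<=` Cn S.
Proof. by move=> f Sf v; apply. Qed.

Lemma Cn_idem S : Cn (Cn S) = Cn S.
Proof.
apply/seteqP; split; last exact: sub_Cn.
by move=> f H v mv; apply: H => g; apply.
Qed.

Lemma Cn_mono S S' : S `<=` S' -> Cn S `<=` Cn S'.
Proof. by move=> sub f; apply: entails_mono. Qed.

Lemma entails_Neg S phi : entails S (Neg phi) <-> ~ satisfiable (phi |` S).
Proof.
split=> [H [v mv]|H v mv].
  have /H /= : model v S by move=> g Sg; apply: mv; right.
  by rewrite mv //; left.
apply/negP => vphi; apply: H; exists v => g [->//|]; exact: mv.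
Qed.

Lemma negated_normal f S :
  negated_justifications (normal_default f) `&` S = set0 <-> ~ S (Neg f).
Proof.
split=> [H Sf|H]; last first.
  by apply/seteqP; split=> // g [[b]]; rewrite /= inE => /eqP-> <-.
have : (negated_justifications (normal_default f) `&` S) (Neg f).
  by split=> //; exists f => //=; rewrite inE.
by rewrite H.
Qed.

Definition normal_theory fs W : default_theory :=
  DefaultTheory [set` map normal_default fs] [set` W].

Section Extensions.
Variables (fs W : seq formula).

Let Delta := normal_theory fs W.

Definition consistent_with (E : set formula) : set formula :=
  [set f | f \in fs /\ ~ E (Neg f)].

(** Every prerequisite is [Top] and blocking depends on [E] alone, so one round of firing defaults
    followed by [Cn] is already closed. *)
Lemma Gamma_normal E : Gamma Delta E = Cn ([set` W] `|` consistent_with E).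
Proof.
apply/seteqP; split; last first.
  move=> f Hf G [[CG HG] WG]; rewrite -CG; apply: Cn_mono Hf.
  move=> g [/WG//|[gfs gE]].
  apply: (HG (normal_default g)); first by apply/map_f.
    by rewrite -CG => v _.
  exact/negated_normal.
move=> f; apply; split; last by move=> g gW; apply: sub_Cn; left.
split; first exact: Cn_idem.
move=> _ /mapP[g gfs ->] _ /negated_normal nE.
by apply: sub_Cn; right.
Qed.

Lemma extensionE E :
  extension Delta E <-> E = Cn ([set` W] `|` consistent_with E).
Proof. by rewrite /extension Gamma_normal; split=> /esym. Qed.

Lemma extension_Cn E : extension Delta E -> Cn E = E.
Proof. by move=> /extensionE H; rewrite H Cn_idem. Qed.

Lemma appl_normal E f : extension Delta E ->
  appl (normal_default f) E <-> ~ E (Neg f).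
Proof.
move=> /extension_Cn CE; rewrite -{2}CE; split=> [[_]|H]; first by move/negated_normal.
by split; [move=> v _|exact/negated_normal].
Qed.

Lemma extension_conclusion E f : extension Delta E -> f \in fs -> ~ E (Neg f) -> E f.
Proof. by move=> /extensionE H ffs nE; rewrite H; apply: sub_Cn; right. Qed.

Lemma extension_facts E f : extension Delta E -> f \in W -> E f.
Proof. by move=> /extensionE H fW; rewrite H; apply: sub_Cn; left. Qed.

Variables (P : default -> default -> Prop) (rank : formula -> nat) (acc : seq formula).
Hypothesis Ptotal : strict_total_order_on [set` map normal_default fs] P.
Hypothesis rankP : forall f g, P (normal_default g) (normal_default f) -> rank g < rank f.
Hypothesis acc_fs : {subset acc <= fs}.
(** Conditional because a formula lying in an unsatisfiable [W] may still be accepted. *)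
Hypothesis acc_sat : satisfiable [set` W] -> satisfiable [set` W ++ acc].
Hypothesis rejected : forall f, f \in fs -> f \notin acc ->
  ~ satisfiable (f |` [set` W] `|`
      [set g | g \in acc /\ P (normal_default g) (normal_default f)]).

Definition greedy_extension : set formula := Cn [set` W ++ acc].

Let E0 := greedy_extension.

Lemma unsat_Cn S f : ~ satisfiable S -> Cn S f.
Proof. by move=> H v mv; case: H; exists v. Qed.

(** A rejected formula contradicts [W] and [acc], so its negation is in [E0]; an accepted one holds
    in a model of [W ++ acc], so its negation is not. *)
Lemma greedy_applied f : satisfiable [set` W] -> f \in fs ->
  (~ E0 (Neg f)) <-> f \in acc.
Proof.
move=> satW ffs; split=> [H|facc].
  apply/negP => /negP/(rejected ffs) R; apply: H; apply/entails_Neg => -/satisfiable_mono H.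
  apply/R/H => g [[->|gW]|[gacc _]]; first by left.
    by right; rewrite /= mem_cat gW.
  by right; rewrite /= mem_cat gacc orbT.
move=> /entails_Neg; apply; apply: satisfiable_mono (acc_sat satW).
by move=> g [->|//]; rewrite /= mem_cat facc orbT.
Qed.

Lemma unsat_greedy f : ~ satisfiable [set` W] -> E0 f.
Proof.
move=> H; apply: unsat_Cn => /satisfiable_mono S; apply: H; apply: S.
by move=> g /= gW; rewrite mem_cat gW.
Qed.

Lemma greedy_is_extension : extension Delta E0.
Proof.
apply/extensionE; have [satW|unsatW] := pselect (satisfiable [set` W]); last first.
  apply/seteqP; split=> f _; last exact: unsat_greedy.
  by apply: unsat_Cn => /satisfiable_mono S; apply/unsatW/S; left.
rewrite {1}/E0 /greedy_extension; congr Cn; apply/seteqP; split=> f.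
  rewrite /= mem_cat => /orP[fW|facc]; [by left|right].
  by have ffs := acc_fs facc; split=> //; apply/greedy_applied.
move=> [/= fW|[ffs]]; first by rewrite mem_cat fW.
by move/(greedy_applied satW ffs); rewrite /= mem_cat orbC => ->.
Qed.

(** Suppose no such [g] exists. Then [E] refutes no accepted formula of higher priority than [f],
    hence, being an extension, contains them all, and a model of [f] and [E] contradicts
    [rejected]. *)
Lemma greedy_dominates E f : extension Delta E -> f \in fs ->
  appl_diff (normal_default f) E E0 ->
  exists2 g, g \in fs & P (normal_default g) (normal_default f) /\
                        appl_diff (normal_default g) E0 E.
Proof.
move=> extE ffs [/(appl_normal _ extE) nE].
move=> /(appl_normal _ greedy_is_extension)/contrapT E0f.
have satW : satisfiable [set` W].
  apply: contrapT => H; apply: nE; have /extensionE -> := extE.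
  by apply: unsat_Cn => /satisfiable_mono S; apply/H/S; left.
have nacc : f \notin acc.
  by apply/negP => /(greedy_applied satW ffs).
apply: contrapT => Hn; apply: (rejected ffs nacc).
have [v mv] : satisfiable (f |` E).
  apply: contrapT => /entails_Neg; apply: contra_not nE => H.
  by rewrite -(extension_Cn extE).
exists v => g [[->|gW]|[gacc Pgf]]; first by apply: mv; left.
  by apply: mv; right; apply: extension_facts.
apply: mv; right; apply: extension_conclusion => //; first exact: acc_fs.
move=> Eg; apply: Hn; exists g; first exact: acc_fs.
split=> //; split.
  by apply/(appl_normal _ greedy_is_extension)/greedy_applied => //; apply: acc_fs.
by move/(appl_normal _ extE).
Qed.

Lemma greedy_preferred : preferred_L Delta P E0.
Proof.
split; first exact: greedy_is_extension.
exists P; split=> // E extE _ /mapP[f ffs ->].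
move=> /(greedy_dominates extE ffs)[g gfs [Pgf ag]].
by exists (normal_default g); split=> //; apply/map_f.
Qed.

(** An extension is determined by the defaults applied in it, so it suffices that [E] and [E0] apply
    the same ones, by induction on the rank. *)
Lemma preferred_unique E : preferred_L Delta P E -> E = E0.
Proof.
move=> [extE [T [[[TD Ttrans Tasym] _] PT HT]]].
have [[PD Ptrans Pasym] Ptot] := Ptotal.
(* [P] is already total, so the strict order [T] extending it adds nothing. *)
have TP d e : T d e -> P d e.
  move=> Tde; have [dD eD] := TD _ _ Tde.
  have de : d <> e by move=> ede; rewrite ede in Tde; exact: (Tasym _ _ Tde Tde).
  by case: (Ptot _ _ dD eD de) => // /PT /Tasym.
have same f : f \in fs ->
    appl (normal_default f) E <-> appl (normal_default f) E0.
  have [n] := ubnP (rank f); elim: n f => // n IH f lt ffs.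
  have IHg g : g \in fs -> P (normal_default g) (normal_default f) ->
      appl (normal_default g) E <-> appl (normal_default g) E0.
    by move=> gfs /rankP gf; apply: IH => //; apply: leq_trans gf _.
  have fD : [set` map normal_default fs] (normal_default f) by apply/map_f.
  split=> a; apply: contrapT => na.
    (* Either way a difference at [f] yields one at some [g] of higher priority: here because [E0]
       dominates [E], below because [E] is preferred and [E0] is an extension. *)
    have [g gfs [Pgf [ag nag]]] := greedy_dominates extE ffs (conj a na).
    by apply/nag/(IHg g gfs Pgf).
  have [_ [/mapP[g gfs ->] /TP Pgf [ag nag]]] :=
    HT _ greedy_is_extension _ fD (conj a na).
  by apply/nag/(IHg g gfs Pgf).
have /extensionE -> := extE; have /extensionE -> := greedy_is_extension.
congr (Cn (_ `|` _)); apply/seteqP; split=> f [ffs H]; split=> //.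
  by apply/(appl_normal _ greedy_is_extension)/same/(appl_normal _ extE).
by apply/(appl_normal _ extE)/same/(appl_normal _ greedy_is_extension).
Qed.

Theorem entails_L_greedy phi :
  entails_L Delta P (Neg phi) <-> ~ satisfiable (phi |` [set` W ++ acc]).
Proof.
split=> [H|H E /preferred_unique ->]; last exact/entails_Neg.
by apply/entails_Neg; apply: H greedy_preferred.
Qed.

End Extensions.
End Logic.

(** * Stack programs *)

Section StackPrograms.
Variables (V G : finType).

Definition store := V -> seq G.
Definition view := {ffun V -> option G}.

Definition upd (s : store) (v : V) (x : seq G) : store :=
  fun u => if u == v then x else s u.

Definition tops (s : store) : view := [ffun v => ohead (s v)].

(** A program may branch on the tops of all stacks at once; views form a finite type, so finitely
    many machine states suffice. *)
Inductive cmd :=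
| Skip
| Push of V & G
| Pop of V
| Seq of cmd & cmd
| Read of (view -> cmd)
| While of pred view & cmd.

(** The cost is the exact number of transitions of the compiled chart. A push takes two, since a
    transition writes before it moves. *)
Inductive exec : cmd -> store -> nat -> store -> Prop :=
| ExecSkip s : exec Skip s 1 s
| ExecPush v x s : exec (Push v x) s 2 (upd s v (x :: s v))
| ExecPop v s : exec (Pop v) s 1 (upd s v (behead (s v)))
| ExecSeq c1 c2 s n s1 m s2 :
    exec c1 s n s1 -> exec c2 s1 m s2 -> exec (Seq c1 c2) s (n + m) s2
| ExecRead f s n s' : exec (f (tops s)) s n s' -> exec (Read f) s n.+1 s'
| ExecWhileDone (p : pred view) c s : ~~ p (tops s) -> exec (While p c) s 1 s
| ExecWhileLoop (p : pred view) c s n s1 m s2 :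
    p (tops s) -> exec c s n s1 -> exec (While p c) s1 m s2 ->
    exec (While p c) s (n + m).+1 s2.

(** * Compilation to Turing machines *)

Definition action := {ffun V -> option G * move}.

Definition idle (a : view) : action := [ffun v => (a v, Stay)].

Definition act_on (v : V) (w : option G * move) (a : view) : action :=
  [ffun u => if u == v then w else (a u, Stay)].

(* A transition to [None] leaves the chart. *)
Record chart := Chart {
  node : finType;
  entry : node;
  next : node -> view -> action * option node }.

(** The view seen on entry is remembered in the state, as the first component of the tagged pair. *)
Definition read_chart (F : view -> chart) : chart :=
  @Chart (option {a : view & node (F a)}) None
    (fun q a =>
       match q with
       | None => (idle a, Some (Some (Tagged (fun a => node (F a)) (entry (F a)))))
       | Some (existT b q) =>
           let r := next q a in
           (r.1, omap (fun q' => Some (Tagged (fun a => node (F a)) q')) r.2)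
       end).

(** A pop erases the cell it leaves, which keeps the cells left of the head blank. In a loop, [None]
    is both the test node and the exit of the body, so [Some r.2] leads from the exit back to the
    test. *)
Fixpoint compile (c : cmd) : chart :=
  match c with
  | Skip => @Chart unit tt (fun _ a => (idle a, None))
  | Push v x =>
      @Chart bool true
        (fun b a => if b then (act_on v (a v, MoveLeft) a, Some false)
                    else (act_on v (Some x, Stay) a, None))
  | Pop v => @Chart unit tt (fun _ a => (act_on v (None, MoveRight) a, None))
  | Seq c1 c2 =>
      let F1 := compile c1 in let F2 := compile c2 in
      @Chart (node F1 + node F2)%type (inl (entry F1))
        (fun q a =>
           match q with
           | inl q => let r := next q a in
               (r.1, Some (if r.2 is Some q' then inl q' else inr (entry F2)))
           | inr q => let r := next q a in (r.1, omap inr r.2)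
           end)
  | Read f => read_chart (fun a => compile (f a))
  | While p c =>
      let F := compile c in
      @Chart (option (node F)) None
        (fun q a =>
           match q with
           | None => (idle a, if p a then Some (Some (entry F)) else None)
           | Some q => let r := next q a in (r.1, Some r.2)
           end)
  end.

Definition tapes := {ffun V -> tape G}.

Definition reads (t : tapes) : view := [ffun v => tape_read (t v)].

Definition act (a : action) (t : tapes) : tapes :=
  [ffun v => tape_write_move (a v) (t v)].

Inductive traverse (F : chart) : node F -> tapes -> nat -> tapes -> Prop :=
| TraverseExit q t a :
    next q (reads t) = (a, None) -> traverse q t 1 (act a t)
| TraverseStep q t a q' n t' :
    next q (reads t) = (a, Some q') -> traverse q' (act a t) n t' ->
    traverse q t n.+1 t'.

Lemma traverse_seql c1 c2 q t n t' m t'' :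
  @traverse (compile c1) q t n t' ->
  @traverse (compile c2) (entry (compile c2)) t' m t'' ->
  @traverse (compile (Seq c1 c2)) (inl q) t (n + m) t''.
Proof.
have seqr q2 t0 k t1 : @traverse (compile c2) q2 t0 k t1 ->
    @traverse (compile (Seq c1 c2)) (inr q2) t0 k t1.
  elim=> {q2 t0 k t1} [q2 t0 a E|q2 t0 a q3 k t1 E _ IH].
    by apply: TraverseExit; rewrite /= E.
  by apply: TraverseStep IH; rewrite /= E.
move=> H1 H2; elim: H1 H2 => {q t n t'} [q t a E|q t a q' n t' E _ IH] H2.
  by apply: TraverseStep (seqr _ _ _ _ H2); rewrite /= E.
by apply: TraverseStep (IH H2); rewrite /= E.
Qed.

Lemma traverse_read f a q t n t' :
  @traverse (compile (f a)) q t n t' ->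
  @traverse (compile (Read f))
    (Some (Tagged (fun a => node (compile (f a))) q)) t n t'.
Proof.
elim=> {q t n t'} [q t b E|q t b q' n t' E _ IH].
  by apply: TraverseExit; rewrite /= E.
by apply: TraverseStep IH; rewrite /= E.
Qed.

Lemma traverse_while p c q t n t' m t'' :
  @traverse (compile c) q t n t' ->
  @traverse (compile (While p c)) None t' m t'' ->
  @traverse (compile (While p c)) (Some q) t (n + m) t''.
Proof.
move=> H1 H2; elim: H1 H2 => {q t n t'} [q t a E|q t a q' n t' E _ IH] H2.
  by apply: TraverseStep H2; rewrite /= E.
by apply: TraverseStep (IH H2); rewrite /= E.
Qed.

(* The top of the stack is under the head and the stack extends to the right,
   so that the initial input tape is the stack of the input symbols. *)
Definition stack_on_tape (s : seq G) (t : tape G) : Prop :=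
  exists j m, t = (nseq j None, map Some s ++ nseq m None).

Lemma behead_nseq {T : Type} m (x : T) : behead (nseq m x) = nseq m.-1 x.
Proof. by case: m. Qed.

Lemma stack_read s t : stack_on_tape s t -> tape_read t = ohead s.
Proof. by case=> j [m ->]; case: s => //=; case: m. Qed.

Lemma stack_stay s t : stack_on_tape s t ->
  stack_on_tape s (tape_write_move (ohead s, Stay) t).
Proof.
case=> j [m ->]; case: s => [|x s]; last by exists j, m.
by exists j, m.-1.+1; rewrite /tape_write_move /= behead_nseq; case: m.
Qed.

Lemma stack_pop s t : stack_on_tape s t ->
  stack_on_tape (behead s) (tape_write_move (None, MoveRight) t).
Proof.
case=> j [m ->]; case: s => [|x s] /=; last by exists j.+1, m.
by exists j.+1, m.-1; rewrite /tape_write_move /= behead_nseq.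
Qed.

Lemma stack_push x s t : stack_on_tape s t ->
  stack_on_tape (x :: s)
    (tape_write_move (Some x, Stay) (tape_write_move (ohead s, MoveLeft) t)).
Proof.
case=> j [m ->]; case: s => [|y s]; rewrite /tape_write_move /= behead_nseq.
  (* Over an empty stack the blank under the head becomes an explicit cell, hence [m.-1.+1]. *)
  by exists j.-1, m.-1.+1; rewrite behead_nseq; case: j.
by exists j.-1, m; case: j.
Qed.

Definition stacks_on_tapes (s : store) (t : tapes) : Prop :=
  forall v, stack_on_tape (s v) (t v).

Lemma stacks_reads s t : stacks_on_tapes s t -> reads t = tops s.
Proof. by move=> H; apply/ffunP=> v; rewrite !ffunE (stack_read (H v)). Qed.

Lemma stacks_idle s t : stacks_on_tapes s t ->
  stacks_on_tapes s (act (idle (tops s)) t).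
Proof. by move=> H v; rewrite !ffunE; apply: stack_stay. Qed.

Lemma compile_exec c s n s' t : exec c s n s' -> stacks_on_tapes s t ->
  exists2 t', stacks_on_tapes s' t' &
    @traverse (compile c) (entry (compile c)) t n t'.
Proof.
move=> H; elim: H t => {c s n s'}
  [s|v x s|v s|c1 c2 s n s1 m s2 _ IH1 _ IH2|f s n s' _ IH|p c s H
  |p c s n s1 m s2 H _ IH1 _ IH2] t st.
- exists (act (idle (tops s)) t); first exact: stacks_idle.
  by apply: TraverseExit; rewrite (stacks_reads st).
- set t1 := act (act_on v (tops s v, MoveLeft) (tops s)) t.
  exists (act (act_on v (Some x, Stay) (reads t1)) t1).
    move=> u; rewrite !ffunE /upd; case: eqP => [->|_].
      exact: stack_push.
    rewrite (stack_read (stack_stay (st u))); apply: stack_stay; exact: stack_stay.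
  apply: (@TraverseStep (compile (Push v x)) _ _ _ false).
    by rewrite /= (stacks_reads st).
  by apply: TraverseExit.
- exists (act (act_on v (None, MoveRight) (tops s)) t).
    move=> u; rewrite !ffunE /upd; case: eqP => [->|_]; first exact: stack_pop.
    exact: stack_stay.
  by apply: TraverseExit; rewrite (stacks_reads st).
- have [t1 st1 r1] := IH1 _ st; have [t2 st2 r2] := IH2 _ st1.
  by exists t2 => //; apply: traverse_seql r1 r2.
- have [t' st' r] := IH _ (stacks_idle st).
  exists t' => //; apply: (TraverseStep _ (traverse_read r)).
  by rewrite /= (stacks_reads st).
- exists (act (idle (tops s)) t); first exact: stacks_idle.
  by apply: TraverseExit; rewrite /= (stacks_reads st) (negbTE H).
- have [t1 st1 r1] := IH1 _ (stacks_idle st); have [t2 st2 r2] := IH2 _ st1.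
  exists t2 => //; apply: (TraverseStep _ (traverse_while r1 r2)).
  by rewrite /= (stacks_reads st) H.
Qed.

Variables (I : Type) (inp : I -> G) (v0 vout : V) (c : cmd).

(** Listing [v0] first puts its stack on tape [ord0], where the input is written. *)
Let others := rem v0 (enum V).
Let number (v : V) : 'I_(size others).+1 := inord (index v (v0 :: others)).
Let name (i : 'I_(size others).+1) : V := nth v0 (v0 :: others) i.

Let numberK : cancel number name.
Proof.
move=> v; have vin : v \in v0 :: others.
  have v0in : v0 \in enum V by rewrite mem_enum.
  by rewrite -(perm_mem (perm_to_rem v0in)) mem_enum.
rewrite /name /number inordK ?nth_index //.
by rewrite -[(size others).+1]/(size (v0 :: others)) index_mem.
Qed.

Let nameK : cancel name number.
Proof.
have v0in : v0 \in enum V by rewrite mem_enum.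
have U : uniq (v0 :: others).
  by rewrite -(perm_uniq (perm_to_rem v0in)) enum_uniq.
by move=> i; rewrite /name /number index_uniq ?inord_val //; apply: ltn_ord.
Qed.

(** State [inr None] follows the chart; one extra transition inspects the stack [vout] and halts,
    hence [n.+1] in [program_machineP]. *)
Let program_delta (q : node (compile c) + option bool)
    (r : {ffun 'I_(size others).+1 -> option G}) :=
  let a : view := [ffun v => r (number v)] in
  let: (b, q') := match q with
    | inl q => let r := next q a in
               (r.1, if r.2 is Some q' then inl q' else inr None)
    | inr _ => (idle a, inr (Some (a vout == None)))
    end in
  (q', [ffun i => b (name i)]).

(* It accepts when the final stack [vout] is empty. *)
Definition program_machine : turing_machine I :=
  @TuringMachine I (size others) G inp
    (node (compile c) + option bool)%type (inl (entry (compile c)))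
    (fun q => if q is inr o then o else None) program_delta.

Definition input_store (w : seq I) : store :=
  fun v => if v == v0 then map inp w else [::].

Let named (t : tapes) : {ffun 'I_(size others).+1 -> tape G} :=
  [ffun i => t (name i)].

Let step_act (a : action) t (b : {ffun 'I_(size others).+1 -> option G * move}) :
  b = [ffun i => a (name i)] ->
  [ffun i => tape_write_move (b i) (named t i)] = named (act a t).
Proof. by move=> ->; apply/ffunP=> i; rewrite !ffunE. Qed.

Let named_reads t : [ffun v => [ffun i => tape_read (named t i)] (number v)]
  = reads t.
Proof. by apply/ffunP=> v; rewrite !ffunE numberK. Qed.

Let step_inl q t a o : next q (reads t) = (a, o) ->
  @tm_step I program_machine (inl q, named t) =
  ((if o is Some q' then inl q' else inr None), named (act a t)).
Proof.
move=> E; rewrite /tm_step /= named_reads E /=; congr (_, _).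
exact: step_act.
Qed.

Let traverse_machine q t n t' : @traverse (compile c) q t n t' ->
  iter n (@tm_step I program_machine) (inl q, named t) = (inr None, named t').
Proof.
elim=> {q t n t'} [q t a E|q t a q' n t' E _ IH]; first by rewrite /= (step_inl E).
by rewrite iterSr (step_inl E).
Qed.

Lemma program_machineP w n s : exec c (input_store w) n s ->
  tm_halts_within program_machine w n.+1 (s vout == [::]).
Proof.
move=> H; pose t0 : tapes := [ffun v => ([::], map Some (input_store w v))].
have st0 : stacks_on_tapes (input_store w) t0.
  by move=> v; exists 0, 0; rewrite ffunE cats0.
have [t' st' r] := compile_exec H st0.
have E0 : tm_init program_machine w = (inl (entry (compile c)), named t0).
  congr (_, _); apply/ffunP=> i; rewrite !ffunE /input_store /=.
  have -> : (name i == v0) = (i == ord0).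
    by rewrite -(can_eq nameK).
  by case: eqP => // _; rewrite -map_comp.
exists n.+1 => //; rewrite E0 /= (traverse_machine r) /tm_step /=.
by rewrite named_reads ffunE (stack_read (st' vout)); case: (s vout).
Qed.

End StackPrograms.

(** * Running stack programs *)

Section Runs.
Variables (V G : finType).
Implicit Types (s : store V G) (u v : V) (c : cmd V G).

Definition runs c s T s' := exists2 n, n <= T & exec c s n s'.

Lemma runs_weaken c s T T' s' : runs c s T s' -> T <= T' -> runs c s T' s'.
Proof. by case=> n le H le'; exists n => //; apply: leq_trans le'. Qed.

Lemma runs_skip s : runs (Skip V G) s 1 s.
Proof. by exists 1 => //; constructor. Qed.

Lemma runs_push v x s : runs (Push v x) s 2 (upd s v (x :: s v)).
Proof. by exists 2 => //; constructor. Qed.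

Lemma runs_pop v s : runs (Pop G v) s 1 (upd s v (behead (s v))).
Proof. by exists 1 => //; constructor. Qed.

Lemma runs_seq c1 c2 s T1 s1 T2 s2 :
  runs c1 s T1 s1 -> runs c2 s1 T2 s2 -> runs (Seq c1 c2) s (T1 + T2) s2.
Proof.
move=> [n le1 H1] [m le2 H2]; exists (n + m); first exact: leq_add.
exact: ExecSeq H1 H2.
Qed.

Lemma runs_read f s T s' : runs (f (tops s)) s T s' -> runs (Read f) s T.+1 s'.
Proof. by case=> n le H; exists n.+1 => //; constructor. Qed.

Lemma runs_while_done (p : pred (view V G)) c s :
  ~~ p (tops s) -> runs (While p c) s 1 s.
Proof. by move=> H; exists 1 => //; constructor. Qed.

Lemma runs_while_loop (p : pred (view V G)) c s T s1 T' s2 :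
  p (tops s) -> runs c s T s1 -> runs (While p c) s1 T' s2 ->
  runs (While p c) s (T + T').+1 s2.
Proof.
move=> H [n le1 H1] [m le2 H2]; exists (n + m).+1; first by rewrite ltnS leq_add.
exact: ExecWhileLoop H1 H2.
Qed.

(* [m] bounds the number of remaining iterations. *)
Lemma runs_while_inv (J : nat -> store V G -> Prop) (p : pred (view V G)) c T m s :
  (forall m s, J m s -> p (tops s) ->
     exists m' s', [/\ m' < m, J m' s' & runs c s T s']) ->
  J m s ->
  exists m' s', [/\ m' <= m, J m' s', ~~ p (tops s') &
                    runs (While p c) s (m * T.+1).+1 s'].
Proof.
move=> step; elim/ltn_ind: m s => m IH s Jms.
have [pT|pF] := boolP (p (tops s)); last first.
  exists m, s; split=> //; apply: runs_weaken (runs_while_done _ pF) _; lia.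
have [m1 [s1 [lt1 J1 r1]]] := step _ _ Jms pT.
have [m2 [s2 [le2 J2 p2 r2]]] := IH _ lt1 _ J1.
exists m2, s2; split=> //; first by rewrite (leq_trans le2) // ltnW.
apply: runs_weaken (runs_while_loop pT r1 r2) _.
have : m1.+1 * T.+1 <= m * T.+1 by rewrite leq_mul2r lt1 orbT.
lia.
Qed.

(** Stores are indexed by the set of finished indices, so that the effect of one index can be stated
    without reference to the order of [r]. *)
Lemma runs_foreach (I : eqType) (r : seq I) (c : I -> cmd V G)
    (S : pred I -> store V G) T :
  uniq r ->
  (forall (d : pred I) i, ~~ d i -> runs (c i) (S d) T (S (predU1 i d))) ->
  (forall d d', d =1 d' -> S d = S d') ->
  runs (foldr (fun i c' => Seq (c i) c') (Skip V G) r) (S pred0)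
    (size r * T).+1 (S (mem r)).
Proof.
move=> Ur Hc Sext.
suff H d : (forall i, i \in r -> ~~ d i) ->
    runs (foldr (fun i c' => Seq (c i) c') (Skip V G) r) (S d)
      (size r * T).+1 (S (predU d (mem r))) by have := H pred0 (fun _ _ => isT).
elim: r d Ur => [|i r IH] d /= => [_ _|/andP[ir Ur] dr].
  by rewrite (Sext (predU d (mem [::])) d); [exact: runs_skip|move=> x /=; rewrite orbF].
rewrite (Sext (predU d (mem (i :: r))) (predU (predU1 i d) (mem r))); last first.
  by move=> x /=; rewrite inE orbCA orbA.
apply: (@runs_weaken _ _ (T + (size r * T).+1)); last by lia.
apply: runs_seq (Hc d i (dr i (mem_head _ _))) (IH _ Ur _) => j jr /=.
rewrite negb_or dr ?inE ?jr ?orbT // andbT; apply: contraNneq ir => <- //.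
Qed.

Lemma topsE s v : tops s v = ohead (s v).
Proof. exact: ffunE. Qed.

Lemma upd_same s v x : upd s v x v = x.
Proof. by rewrite /upd eqxx. Qed.

Lemma upd_neq s u v x : u != v -> upd s v x u = s u.
Proof. by rewrite /upd => /negbTE ->. Qed.

Lemma upd_upd s v x y : upd (upd s v x) v y = upd s v y.
Proof. by apply/funext => u; rewrite /upd; case: eqP. Qed.

Lemma upd_id s v x : s v = x -> upd s v x = s.
Proof. by move=> <-; apply/funext => u; rewrite /upd; case: eqP => // ->. Qed.

Definition top_is (p : pred G) u : pred (view V G) :=
  fun a => if a u is Some x then p x else false.

(** Doing nothing on an empty stack lets [compare_loop] consume two stacks of different lengths in
    lockstep. *)
Definition transfer u v : cmd V G :=
  Read (fun a => if a u is Some x then Seq (Push v x) (Pop G u) else Skip V G).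

Lemma runs_transfer u v s : u != v ->
  runs (transfer u v) s 4
    (upd (upd s u (behead (s u))) v (take 1 (s u) ++ s v)).
Proof.
move=> uv; apply: runs_read; rewrite topsE; case E: (s u) => [|x z] /=.
  rewrite (upd_id E) upd_id //; exact: runs_weaken (runs_skip _) _.
rewrite take0; have := runs_seq (runs_push v x s) (runs_pop u _).
congr (runs _ _ _ _); rewrite upd_neq // E /=.
apply/funext => w; rewrite /upd; case: (eqVneq w u) => [->|//].
by rewrite (negbTE uv).
Qed.

Definition move_while (p : pred G) u v := While (top_is p u) (transfer u v).

(** Each letter costs 4 for [transfer] and 1 for the loop test. *)
Lemma runs_move p u v s w z : u != v -> s u = w ++ z -> all p w ->
  ~~ (if ohead z is Some x then p x else false) ->
  runs (move_while p u v) s (size w * 5).+1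
    (upd (upd s u z) v (rev w ++ s v)).
Proof.
move=> uv + + pz; elim: w s => [|x w IH] s /= E.
  move=> _; rewrite (upd_id E) (upd_id (erefl (s v))).
  by apply: runs_while_done; rewrite /top_is topsE E.
case/andP=> px pw.
have := runs_transfer s uv; rewrite E /= take0.
set s1 := upd _ _ _ => r1.
have E1 : s1 u = w ++ z by rewrite /s1 upd_neq // upd_same.
have pt : top_is p u (tops s) by rewrite /top_is topsE E.
have := runs_while_loop pt r1 (IH _ E1 pw).
congr (runs _ _ _ _).
apply/funext => t; rewrite /s1 /upd eqxx rev_cons cat_rcons.
by case: eqP => [//|_]; case: eqP.
Qed.

Definition drop_while (p : pred G) u := While (top_is p u) (Pop G u).

Lemma runs_drop p u s w z : s u = w ++ z -> all p w ->
  ~~ (if ohead z is Some x then p x else false) ->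
  runs (drop_while p u) s (size w * 2).+1 (upd s u z).
Proof.
move=> + + pz; elim: w s => [|x w IH] s /= E.
  move=> _; rewrite (upd_id E).
  by apply: runs_while_done; rewrite /top_is topsE E.
case/andP=> px pw.
have := runs_pop u s; rewrite E /= => r1.
have pt : top_is p u (tops s) by rewrite /top_is topsE E.
have := runs_while_loop pt r1 (IH _ (upd_same _ _ _) pw).
by rewrite upd_upd.
Qed.

Lemma runs_clear u s : runs (drop_while predT u) s (size (s u) * 2).+1 (upd s u [::]).
Proof. by apply: runs_drop; rewrite ?cats0 ?all_predT. Qed.

Definition move_all u v := move_while predT u v.

Lemma runs_move_all u v s : u != v ->
  runs (move_all u v) s (size (s u) * 5).+1
    (upd (upd s u [::]) v (rev (s u) ++ s v)).
Proof. by move=> uv; apply: runs_move; rewrite ?cats0 ?all_predT. Qed.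

(** Moving reverses. After a first move, this second one restores the original and leaves a copy in
    the original order on [t]. *)
Definition move_copy (g : G -> G) u v t : cmd V G :=
  While (top_is predT u)
    (Read (fun a => if a u is Some x
                    then Seq (Push t (g x)) (transfer u v) else Skip V G)).

Lemma runs_move_copy g u v t s : u != v -> u != t -> v != t ->
  runs (move_copy g u v t) s (size (s u) * 8).+1
    (upd (upd (upd s u [::]) v (rev (s u) ++ s v)) t (map g (rev (s u)) ++ s t)).
Proof.
move=> uv ut vt; move: {-1}(s u) (erefl (s u)) => w.
elim: w s => [|x w IH] s E /=.
  rewrite (upd_id E) !upd_id //.
  by apply: runs_while_done; rewrite /top_is topsE E.
have pt : top_is predT u (tops s) by rewrite /top_is topsE E.
have := runs_transfer (upd s t (g x :: s t)) uv.
rewrite !upd_neq // E /= take0; set s1 := upd _ v _ => r1.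
have tu : t != u by rewrite eq_sym.
have tv : t != v by rewrite eq_sym.
have vu : v != u by rewrite eq_sym.
have E1 : s1 u = w by rewrite /s1 upd_neq // upd_same.
have r2 : runs (Read (fun a => if a u is Some x
             then Seq (Push t (g x)) (transfer u v) else Skip V G)) s 7 s1.
  by apply: runs_read; rewrite topsE E /=; apply: runs_seq (runs_push _ _ _) r1.
have := runs_while_loop pt r2 (IH _ E1).
congr (runs _ _ _ _).
apply/funext => y; rewrite /s1 /upd eqxx (negbTE tv) (negbTE tu) eqxx.
rewrite rev_cons map_rcons !cat_rcons.
by case: (y == t); case: (y == v); case: (y == u).
Qed.

End Runs.

Arguments Skip {V G}.
Arguments Pop {V G}.
Arguments transfer {V G}.
Arguments move_all {V G}.

(** * Simulation of the satisfiability machine *)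

Definition symbols : seq symbol :=
  [:: sVar; sBit true; sBit false; sEnd; sTop; sBot; sNeg; sAnd; sOr; sImp; sIff;
      sColon; sComma; sSlash; sHigher; sSep; sBar].

(** Stack letters must form a [finType], so the encoding alphabet receives that structure by
    transport from ['I_17]. *)
Definition symbol_rank (x : symbol) : 'I_17 :=
  match x with
  | sVar => @Ordinal 17 0 isT
  | sBit true => @Ordinal 17 1 isT
  | sBit false => @Ordinal 17 2 isT
  | sEnd => @Ordinal 17 3 isT
  | sTop => @Ordinal 17 4 isT
  | sBot => @Ordinal 17 5 isT
  | sNeg => @Ordinal 17 6 isT
  | sAnd => @Ordinal 17 7 isT
  | sOr => @Ordinal 17 8 isT
  | sImp => @Ordinal 17 9 isT
  | sIff => @Ordinal 17 10 isT
  | sColon => @Ordinal 17 11 isT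
  | sComma => @Ordinal 17 12 isT
  | sSlash => @Ordinal 17 13 isT
  | sHigher => @Ordinal 17 14 isT
  | sSep => @Ordinal 17 15 isT
  | sBar => @Ordinal 17 16 isT
  end.

Lemma symbol_rankK : cancel symbol_rank (fun i => nth sVar symbols i).
Proof. by do !case. Qed.

HB.instance Definition _ := Equality.copy symbol (can_type symbol_rankK).
HB.instance Definition _ := Choice.copy symbol (can_type symbol_rankK).
HB.instance Definition _ := Countable.copy symbol (can_type symbol_rankK).
HB.instance Definition _ := Finite.copy symbol (can_type symbol_rankK).

Section Simulation.
Variables (M : turing_machine symbol) (K : nat) (rq rres : 'I_K).
Hypothesis rqres : rq != rres.

Local Notation n := (tm_tapes M).+1.

(* [K] registers, and two stacks for each tape of [M]. *)
Definition stack_name : finType := ('I_K + 'I_n * bool)%type.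

(** Blanks of the simulated tapes are letters too, since a blank may lie above a written cell. The
    control state is a letter kept on register [rq]. *)
Definition letter : finType :=
  (symbol + (option (tm_symbol M) + tm_state M))%type.

Definition Sy (x : symbol) : letter := inl x.
Definition Cell (x : option (tm_symbol M)) : letter := inr (inl x).
Definition St (q : tm_state M) : letter := inr (inr q).

(** The default of [nth] makes registers beyond the end of [r] empty. The flag [true] selects the
    half of a tape that starts under the head. *)
Definition memory (r : seq (seq letter)) (t : 'I_n -> tape (tm_symbol M)) :
    store stack_name letter :=
  fun v => match v with
           | inl i => nth [::] r i
           | inr (i, b) => map Cell (if b then (t i).2 else (t i).1)
           end.

Lemma memory_upd r t (i : 'I_K) x :
  upd (memory r t) (inl i) x = memory (set_nth [::] r i x) t.
Proof. by apply/funext=> -[j|[j b]]; rewrite /upd //= nth_set_nth. Qed.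

Definition fupd {T : Type} (t : 'I_n -> T) (i : 'I_n) (x : T) : 'I_n -> T :=
  fun j => if j == i then x else t j.

Lemma memory_updl r t (i : 'I_n) x :
  upd (memory r t) (inr (i, false)) (map Cell x) = memory r (fupd t i (x, (t i).2)).
Proof.
apply/funext=> -[j|[j b]]; rewrite /upd /fupd //=.
rewrite (inj_eq (@inr_inj _ _)) xpair_eqE.
by case: eqP => [->|//]; case: b.
Qed.

Lemma memory_updr r t (i : 'I_n) x :
  upd (memory r t) (inr (i, true)) (map Cell x) = memory r (fupd t i ((t i).1, x)).
Proof.
apply/funext=> -[j|[j b]]; rewrite /upd /fupd //=.
rewrite (inj_eq (@inr_inj _ _)) xpair_eqE.
by case: eqP => [->|//]; case: b.
Qed.

Lemma fupd_fupd {T : Type} (t : 'I_n -> T) i x y :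
  fupd (fupd t i x) i y = fupd t i y.
Proof. by apply/funext=> j; rewrite /fupd; case: eqP. Qed.

Lemma fupd_same {T : Type} (t : 'I_n -> T) i x : fupd t i x i = x.
Proof. by rewrite /fupd eqxx. Qed.

Local Notation Left i := (inr (i, false) : stack_name).
Local Notation Right i := (inr (i, true) : stack_name).
Local Notation cmdM := (cmd stack_name letter).

Definition uncell (x : option letter) : option (tm_symbol M) :=
  if x is Some (inr (inl y)) then y else None.

Lemma uncell_ohead x : uncell (ohead (map Cell x)) = head None x.
Proof. by case: x. Qed.

(** An empty half reads as a blank through [uncell] and ignores [Pop], as [head None] and [behead]
    do in [tape_write_move]. *)
Definition tape_cmd (a : view stack_name letter) (i : 'I_n)
    (w : option (tm_symbol M) * move) : cmdM :=
  match w.2 with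
  | MoveLeft =>
      Seq (Pop (Right i)) (Seq (Push (Right i) (Cell w.1))
        (Seq (Push (Right i) (Cell (uncell (a (Left i))))) (Pop (Left i))))
  | Stay => Seq (Pop (Right i)) (Push (Right i) (Cell w.1))
  | MoveRight => Seq (Push (Left i) (Cell w.1)) (Pop (Right i))
  end.

Lemma runs_tape_cmd (a : view stack_name letter) r t i w :
  a (Left i) = ohead (map Cell (t i).1) ->
  runs (tape_cmd a i w) (memory r t) 6 (memory r (fupd t i (tape_write_move w (t i)))).
Proof.
have pushl r' t' x : runs (Push (Left i) (Cell x)) (memory r' t') 2
    (memory r' (fupd t' i (x :: (t' i).1, (t' i).2))).
  by have := runs_push (Left i) (Cell x) (memory r' t');
     rewrite -[_ :: _]/(map Cell (x :: (t' i).1)) memory_updl.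
have pushr r' t' x : runs (Push (Right i) (Cell x)) (memory r' t') 2
    (memory r' (fupd t' i ((t' i).1, x :: (t' i).2))).
  by have := runs_push (Right i) (Cell x) (memory r' t');
     rewrite -[_ :: _]/(map Cell (x :: (t' i).2)) memory_updr.
have popl r' t' : runs (Pop (Left i)) (memory r' t') 1
    (memory r' (fupd t' i (behead (t' i).1, (t' i).2))).
  by have := @runs_pop _ letter (Left i) (memory r' t');
     rewrite /= behead_map memory_updl.
have popr r' t' : runs (Pop (Right i)) (memory r' t') 1
    (memory r' (fupd t' i ((t' i).1, behead (t' i).2))).
  by have := @runs_pop _ letter (Right i) (memory r' t');
     rewrite /= behead_map memory_updr.
case: w => x [] /= Ea; rewrite /tape_cmd /= ?Ea ?uncell_ohead.
- have := runs_seq (popr r t) (runs_seq (pushr _ _ x)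
    (runs_seq (pushr _ _ (head None (t i).1)) (popl _ _))).
  by rewrite !fupd_same !fupd_fupd.
- have := runs_seq (popr r t) (pushr _ _ x).
  by rewrite !fupd_same !fupd_fupd => H; apply: runs_weaken H _.
- have := runs_seq (pushl r t x) (popr _ _).
  by rewrite !fupd_same !fupd_fupd => H; apply: runs_weaken H _.
Qed.

Definition on_tapes (c : 'I_n -> cmdM) : cmdM :=
  foldr (fun i c' => Seq (c i) c') Skip (enum 'I_n).

(** The hypothesis leaves the other tapes arbitrary, since those handled earlier have already
    changed. *)
Lemma runs_on_tapes (c : 'I_n -> cmdM) r t t' T :
  (forall t0 i, t0 i = t i -> runs (c i) (memory r t0) T (memory r (fupd t0 i (t' i)))) ->
  runs (on_tapes c) (memory r t) (n * T).+1 (memory r t').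
Proof.
move=> H.
pose S (d : pred 'I_n) := memory r (fun i => if d i then t' i else t i).
have -> : memory r t' = S (mem (enum 'I_n)).
  by congr memory; apply/funext=> i; rewrite /= mem_enum.
rewrite -[X in (X * _).+1](size_enum_ord n).
apply: (@runs_foreach _ _ _ _ _ S) => [|d i di|d d' dd']; first exact: enum_uniq.
  have := H (fun i => if d i then t' i else t i) i; rewrite (negbTE di).
  move=> /(_ erefl); congr (runs _ _ _ (memory _ _)).
  by apply/funext=> j; rewrite /fupd /=; case: eqP => // ->.
by congr memory; apply/funext=> i; rewrite dd'.
Qed.

Definition state_of (a : view stack_name letter) : option (tm_state M) :=
  if a (inl rq) is Some (inr (inr q)) then Some q else None.

Definition sim_step : cmdM :=
  Read (fun a =>
    if state_of a is Some q then
      let d := tm_delta q [ffun i => uncell (a (Right i))] in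
      Seq (Seq (Pop (inl rq)) (Push (inl rq) (St d.1)))
          (on_tapes (fun i => tape_cmd a i (d.2 i)))
    else Skip).

Definition config_memory r (c : tm_config M) : store stack_name letter :=
  memory (set_nth [::] r rq [:: St c.1]) c.2.

(** Replacing the state costs 3, each tape 6, the closing [Skip] and the [Read] 1 each. *)
Definition step_time := (3 + (n * 6).+1).+1.

Lemma config_memory_state r c : state_of (tops (config_memory r c)) = Some c.1.
Proof. by rewrite /state_of topsE /= nth_set_nth /= eqxx. Qed.

Lemma runs_sim_step r c : tm_answer c.1 = None ->
  runs sim_step (config_memory r c) step_time (config_memory r (tm_step c)).
Proof.
move=> Ec; apply: runs_read; rewrite config_memory_state /tm_step Ec.
have -> : [ffun i => uncell (tops (config_memory r c) (Right i))] =
          [ffun i => tape_read (c.2 i)].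
  by apply/ffunP=> i; rewrite !ffunE uncell_ohead.
set d := tm_delta _ _.
have := runs_seq (runs_pop (inl rq) (config_memory r c))
  (runs_push (inl rq) (St d.1) _).
rewrite upd_upd upd_same {2}/config_memory memory_upd set_set_nth eqxx.
rewrite {2}/config_memory /= nth_set_nth /= eqxx /= => r1.
apply: runs_seq r1 _; rewrite /config_memory /=.
apply: runs_on_tapes => t0 i E.
rewrite ffunE -E; apply: runs_tape_cmd.
by rewrite topsE /= E.
Qed.

Definition running (a : view stack_name letter) : bool :=
  if state_of a is Some q then tm_answer q == None else false.

Definition config_size (c : tm_config M) (i : 'I_n) :=
  maxn (size (c.2 i).1) (size (c.2 i).2).

(** Two rather than one: moving left from an empty right half creates both the written cell and the
    cell now under the head. *)
Lemma config_size_step c i : config_size (tm_step c) i <= (config_size c i).+2.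
Proof.
rewrite /config_size /tm_step; case: tm_answer => [_|] /=; first by lia.
rewrite !ffunE; move: ((tm_delta _ _).2 i) => -[x []] /=;
  by rewrite /= ?size_behead; lia.
Qed.

(** A halting configuration is a fixed point of [tm_step], so a loop that stops early has the same
    answer as [j] steps. The size bound pays for clearing the tapes afterwards. *)
Lemma runs_sim_loop r c j b :
  tm_answer (iter j (@tm_step _ M) c).1 = Some b ->
  exists c', [/\ tm_answer c'.1 = Some b,
    forall i, config_size c' i <= config_size c i + j.*2 &
    runs (While running sim_step) (config_memory r c) (j * step_time.+1).+1
         (config_memory r c')].
Proof.
elim: j c => [|j IH] c.
  move=> /= E; exists c; split=> // [i|]; first by rewrite addn0.
  by apply: runs_while_done; rewrite /running config_memory_state E.
rewrite iterSr => Hb; have [c' [Ec' sz rc']] := IH _ Hb.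
case E: (tm_answer c.1) => [b'|].
  have Ec : tm_step c = c by rewrite /tm_step E.
  exists c; split=> // [|i|]; last 2 first.
  - by rewrite leq_addr.
  - apply: runs_weaken (runs_while_done _ _) _ => //.
    by rewrite /running config_memory_state E.
  have : iter j (@tm_step _ M) c = c by apply: iter_fix.
  by move: Hb; rewrite Ec => + H; rewrite H.
exists c'; split=> // [i|].
  by have := sz i; have := config_size_step c i; lia.
have pt : running (tops (config_memory r c)) by rewrite /running config_memory_state E.
apply: runs_weaken (runs_while_loop pt (runs_sim_step r E) rc') _.
lia.
Qed.

(** Every call of the machine must start on blank tapes. *)
Definition clear_tapes : cmdM :=
  on_tapes (fun i => Seq (drop_while predT (Left i)) (drop_while predT (Right i))).

Lemma runs_clear_tapes r t B :
  (forall i, maxn (size (t i).1) (size (t i).2) <= B) ->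
  runs clear_tapes (memory r t) (n * (B * 4).+2).+1 (memory r (fun=> ([::], [::]))).
Proof.
move=> H; apply: runs_on_tapes => t0 i E.
have r1 := runs_clear (Left i) (memory r t0).
have r2 := runs_clear (Right i) (upd (memory r t0) (Left i) [::]).
have := runs_seq r1 r2; rewrite -[[::]]/(map Cell [::]) memory_updl memory_updr.
rewrite fupd_fupd fupd_same /=  !size_map fupd_same /= E => r3.
by apply: runs_weaken r3 _; have := H i; lia.
Qed.

(* A non-empty [rres] means acceptance. *)
Definition run_machine : cmdM :=
  Seq (Push (inl rq) (St (tm_start M)))
  (Seq (While running sim_step)
  (Seq (Read (fun a =>
      if obind (fun q => tm_answer q) (state_of a) == Some true
      then Push (inl rres) (Sy sTop) else Skip))
  (Seq (Pop (inl rq)) clear_tapes))).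

Definition input_tapes (w : seq symbol) : 'I_n -> tape (tm_symbol M) :=
  fun i => if i == ord0 then ([::], [seq Some (tm_input M x) | x <- w])
           else ([::], [::]).

(** [l + t.*2] bounds both halves of each tape after [t] steps on an input of length [l]; it prices
    the clearing. *)
Definition machine_time l t :=
  2 + ((t * step_time.+1).+1 + (3 + (1 + (n * ((l + t.*2) * 4).+2).+1))).

Lemma runs_run_machine r w t b : nth [::] r rq = [::] -> nth [::] r rres = [::] ->
  tm_halts_within M w t b ->
  runs run_machine (memory r (input_tapes w)) (machine_time (size w) t)
    (memory (set_nth [::] r rres (if b then [:: Sy sTop] else [::]))
         (fun=> ([::], [::]))).
Proof.
move=> Erq Err [j jt Hb].
have nqr : (rq == rres :> nat) = false by apply/negbTE.
have [c [Ec sz rc]] := runs_sim_loop r Hb.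
have r1 : runs (Push (inl rq) (St (tm_start M))) (memory r (input_tapes w)) 2
    (config_memory r (tm_init M w)).
  have := runs_push (inl rq) (St (tm_start M)) (memory r (input_tapes w)).
  rewrite /= Erq memory_upd; congr (runs _ _ _ _).
  by congr memory; apply/funext=> i; rewrite ffunE.
have r3 : runs (Read (fun a =>
      if obind (fun q => tm_answer q) (state_of a) == Some true
      then Push (inl rres) (Sy sTop) else Skip)) (config_memory r c) 3
   (memory (set_nth [::] (set_nth [::] r rq [:: St c.1]) rres
      (if b then [:: Sy sTop] else [::])) c.2).
  rewrite -memory_upd.
  have Er : config_memory r c (inl rres) = [::].
    by rewrite /config_memory /= nth_set_nth /= eq_sym nqr.
  apply: runs_read; rewrite -/(config_memory r c) config_memory_state /= Ec.
  case: b {Hb Ec} => /=.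
    by have := runs_push (inl rres) (Sy sTop) (config_memory r c); rewrite Er.
  rewrite upd_id //; apply: runs_weaken (runs_skip _) _; lia.
have := runs_pop (inl rq) (upd (config_memory r c) (inl rres)
          (if b then [:: Sy sTop] else [::])).
rewrite upd_neq; last by rewrite (inj_eq (@inl_inj _ _)).
rewrite {2}/config_memory /= nth_set_nth /= eqxx /=.
rewrite !memory_upd => r4.
have sz_c i : maxn (size (c.2 i).1) (size (c.2 i).2) <= size w + j.*2.
  apply: leq_trans (sz i) _; rewrite leq_add2r /config_size ffunE.
  by case: eqP => //=; rewrite !size_map max0n.
have := runs_seq r1 (runs_seq rc (runs_seq r3 (runs_seq r4
          (runs_clear_tapes _ sz_c)))).
have le : machine_time (size w) j <= machine_time (size w) t.
  rewrite /machine_time; have := leq_mul jt (leqnn step_time.+1).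
  have := leq_mul (leqnn n) (leq_mul (leq_add (leqnn (size w))
            (leq_mul jt (leqnn 2))) (leqnn 4)).
  lia.
move=> /runs_weaken/(_ le); congr (runs _ _ _ _).
apply/funext=> -[i|[i k]] //=; rewrite !nth_set_nth /=.
case: eqP => [->|/eqP iq]; first by rewrite nqr Erq.
by rewrite !nth_set_nth /= nth_set_nth /= (negbTE iq).
Qed.

End Simulation.

(** * Formula lists on registers *)

(** This makes it safe to find the end of a formula by scanning for a separator. *)
Lemma enc_formula_sep f x : x \in enc_formula f ->
  x \notin [:: sColon; sComma; sSlash; sHigher; sSep; sBar].
Proof.
elim: f x => [a|||g IH|g IHg h IHh|g IHg h IHh|g IHg h IHh|g IHg h IHh] x /=;
  rewrite !inE ?mem_cat ?mem_rcons ?inE.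
- by case/or3P=> [/eqP->//|/eqP->//|/mapP[[] _ ->]].
- by move/eqP->.
- by move/eqP->.
- by case/orP=> [/eqP->|/IH] //; rewrite !inE.
all: by case/or3P=> [/eqP->|/IHg|/IHh] //; rewrite !inE.
Qed.

(** Polish notation fixes where a formula ends. Arbitrary tails are carried along so that a binary
    connective can be split operand by operand. *)
Lemma enc_formula_prefix_free f g s t :
  enc_formula f ++ s = enc_formula g ++ t -> f = g /\ s = t.
Proof.
elim: f g s t => [a|||f IH|f1 IH1 f2 IH2|f1 IH1 f2 IH2|f1 IH1 f2 IH2|f1 IH1 f2 IH2]
  [b|||g|g1 g2|g1 g2|g1 g2|g1 g2] s t //=.
- move=> [/=]; rewrite !cat_rcons.
  suff H : forall a b : atom, map sBit a ++ sEnd :: s = map sBit b ++ sEnd :: t ->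
      a = b /\ s = t by move=> /H[-> ->].
  elim=> [|x a' IH] [|y b'] //= []; first by move=> ->.
  by move=> -> /IH[-> ->].
- by case.
- by case.
- by case=> /IH[-> ->].
all: by rewrite -!catA => -[/IH1[-> /IH2[-> ->]]].
Qed.

Lemma enc_formula_inj : injective enc_formula.
Proof.
move=> f g E; have := @enc_formula_prefix_free f g [::] [::].
by rewrite !cats0 => /(_ E)[].
Qed.

Section Registers.
Variable M : turing_machine symbol.

Local Notation V := (stack_name M 14).
Local Notation G := (letter M).
Local Notation reg k := (inl (@Ordinal 14 k isT) : V).
Local Notation Rg i := (inl i : V).
(* [X] holds the formula in hand and [Y] an entry of a list, both reversed; [X']
   and [Y'] save them during a comparison, which marks mismatches on [Err]; [Li]
   holds a list being rebuilt and [Fo] is the flag of a successful search. *)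
Local Notation X := (@Ordinal 14 0 isT).
Local Notation Y := (@Ordinal 14 1 isT).
Local Notation X' := (@Ordinal 14 2 isT).
Local Notation Y' := (@Ordinal 14 3 isT).
Local Notation Err := (@Ordinal 14 4 isT).
Local Notation Li := (@Ordinal 14 5 isT).
Local Notation Fo := (@Ordinal 14 6 isT).
Local Notation Cmd := (cmd V G).
Local Notation sep := (Sy M sSep).
Local Notation memory := (@memory M 14).
Implicit Types (r : seq (seq G)) (t : 'I_(tm_tapes M).+1 -> tape (tm_symbol M)).
Implicit Types (i k : 'I_14) (f g : formula) (L : seq formula).

Definition str (w : seq symbol) : seq G := map (Sy M) w.

Definition fstr f := str (enc_formula f).

Definition lstr L := str (enc_list enc_formula L).

Lemma Sy_inj : injective (Sy M).
Proof. by move=> x y []. Qed.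

Lemma fstr_inj : injective fstr.
Proof. by move=> f g /(inj_map Sy_inj)/enc_formula_inj. Qed.

Lemma lstr_cons f L : lstr (f :: L) = fstr f ++ sep :: lstr L.
Proof. by rewrite /lstr /fstr /str /enc_list /= map_cat map_rcons cat_rcons. Qed.

Lemma sep_fstr f : all (predC1 sep) (fstr f).
Proof.
apply/allP=> y /mapP[x /enc_formula_sep xf ->] /=.
by rewrite (inj_eq Sy_inj); apply: contraNneq xf => ->.
Qed.

Definition fsize f := size (enc_formula f).

Definition lsize L := size (enc_list enc_formula L).

Lemma size_fstr f : size (fstr f) = fsize f.
Proof. by rewrite size_map. Qed.

Lemma lsize_cons f L : lsize (f :: L) = (fsize f + lsize L).+1.
Proof. by rewrite /lsize /enc_list /= size_cat size_rcons. Qed.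

Lemma size_le_lsize L : size L <= lsize L.
Proof. by elim: L => // f L IH; rewrite lsize_cons /=; lia. Qed.

Lemma fsize_lt_lsize f L : f \in L -> fsize f < lsize L.
Proof.
elim: L => // g L IH; rewrite lsize_cons inE => /predU1P[->|/IH]; lia.
Qed.

Lemma lstr_nil_eq L : (ohead (lstr L) == None) = (L == [::]).
Proof. by case: L => // f L; rewrite lstr_cons; case: (fstr f). Qed.

Lemma run_push i x r t :
  runs (Push (Rg i) x) (memory r t) 2
       (memory (set_nth [::] r i (x :: nth [::] r i)) t).
Proof. by rewrite -memory_upd; apply: runs_push. Qed.

Lemma run_pop i r t :
  runs (Pop (Rg i)) (memory r t) 1
       (memory (set_nth [::] r i (behead (nth [::] r i))) t).
Proof. by rewrite -memory_upd; apply: runs_pop. Qed.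

Lemma inl_neq i k : i != k -> (Rg i) != inl k.
Proof. by rewrite (inj_eq (@inl_inj _ _)). Qed.

Lemma run_transfer i k r t : i != k ->
  runs (transfer (Rg i) (Rg k)) (memory r t) 4
    (memory (set_nth [::] (set_nth [::] r i (behead (nth [::] r i))) k
                (take 1 (nth [::] r i) ++ nth [::] r k)) t).
Proof. by move=> ik; rewrite -!memory_upd; apply/runs_transfer/inl_neq. Qed.

Lemma run_move_all i k r t : i != k ->
  runs (move_all (Rg i) (Rg k)) (memory r t) (size (nth [::] r i) * 5).+1
    (memory (set_nth [::] (set_nth [::] r i [::]) k
                (rev (nth [::] r i) ++ nth [::] r k)) t).
Proof. by move=> ik; rewrite -!memory_upd; apply/runs_move_all/inl_neq. Qed.

Lemma run_clear i r t :
  runs (drop_while predT (Rg i)) (memory r t) (size (nth [::] r i) * 2).+1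
    (memory (set_nth [::] r i [::]) t).
Proof. by rewrite -!memory_upd; apply/runs_clear. Qed.

(** [pull] reverses an entry and [store_entry] reverses it back, so an entry can pass through a
    register with its code intact. *)
Definition pull i k : Cmd :=
  Seq (move_while (predC1 sep) (Rg i) (Rg k)) (Pop (Rg i)).

Lemma run_pull i k w z r t : i != k ->
  nth [::] r i = w ++ sep :: z -> all (predC1 sep) w ->
  runs (pull i k) (memory r t) ((size w) * 5).+2
    (memory (set_nth [::] (set_nth [::] r i z) k (rev w ++ nth [::] r k)) t).
Proof.
move=> ik E wsep; have ik' := inl_neq ik.
have Ei : memory r t (Rg i) = w ++ sep :: z by [].
have Ez : ~~ (if ohead (sep :: z) is Some x then predC1 sep x else false) by [].
have := runs_seq (runs_move ik' Ei wsep Ez) (runs_pop (Rg i) _).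
rewrite -!memory_upd addn1; congr (runs _ _ _ _).
by apply/funext=> v; rewrite /upd eqxx (negbTE ik'); case: eqP => // ->;
  rewrite (negbTE ik').
Qed.

Definition store_entry k i : Cmd :=
  Seq (Push (Rg i) sep) (move_all (Rg k) (Rg i)).

Lemma run_store_entry k i r t : i != k ->
  runs (store_entry k i) (memory r t) ((size (nth [::] r k)) * 5).+3
    (memory (set_nth [::] (set_nth [::] r k [::]) i
               (rev (nth [::] r k) ++ sep :: nth [::] r i)) t).
Proof.
move=> ik; have ki : k != i by rewrite eq_sym.
have := runs_seq (run_push i sep r t) (run_move_all _ _ ki).
rewrite !nth_set_nth /= eqxx.
have -> : (k == i :> nat) = false by apply/negbTE.
congr (runs _ _ _ _); rewrite -!memory_upd.
by apply/funext=> v; rewrite /upd; case: eqP.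
Qed.

Definition compare_loop : Cmd :=
  While (fun a => (a (reg 0) != None) || (a (reg 1) != None))
    (Seq (Read (fun a => if a (reg 0) != a (reg 1) then Push (reg 4) sep else Skip))
       (Seq (transfer (reg 0) (reg 2)) (transfer (reg 1) (reg 3)))).

(** [m] counts the mismatched positions. An iteration shortens at least one of the two words, so the
    sum of the lengths bounds the number of iterations. *)
Lemma run_compare_loop x y x' y' e l b r t :
  exists m, [/\ (m == 0) = (x == y), m <= size x + size y &
    runs compare_loop (memory [:: x, y, x', y', e, l, b & r] t)
      ((size x + size y) * 12).+1
      (memory [:: [::], [::], rev x ++ x', rev y ++ y', nseq m sep ++ e, l, b & r] t)].
Proof.
have [N] := ubnP (size x + size y); elim: N x y x' y' e => // N IH x y x' y' e lt.
have [xy0|xyN] := boolP (nilp x && nilp y).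
  have [/nilP-> /nilP->] := andP xy0.
  exists 0; split=> //; apply: runs_while_done.
  by rewrite !topsE.
have lt' : size (behead x) + size (behead y) < size x + size y.
  by move: xyN; rewrite !size_behead /nilp; case: (size x) (size y) => [|?] [|?] //=; lia.
(* Comparing optional tops counts a position where only one word has ended as a mismatch. *)
pose d : nat := ohead x != ohead y.
have [m [Em lem rm]] := IH (behead x) (behead y) (take 1 x ++ x') (take 1 y ++ y')
  (nseq d sep ++ e) (leq_trans lt' lt).
exists (m + d); split.
- rewrite addn_eq0 Em eqb0 negbK.
  by case: (x) (y) => [|u p] [|v q] //=; rewrite ?andbF // eqseq_cons andbC.
- by move: lt'; rewrite /d; case: (_ != _); lia.
have p : (fun a : view V G => (a (reg 0) != None) || (a (reg 1) != None))
    (tops (memory [:: x, y, x', y', e, l, b & r] t)).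
  by rewrite !topsE /=; case: (x) xyN => //; case: (y).
have rd : runs (Read (fun a : view V G =>
      if a (reg 0) != a (reg 1) then Push (reg 4) sep else Skip))
      (memory [:: x, y, x', y', e, l, b & r] t) 3
      (memory [:: x, y, x', y', nseq d sep ++ e, l, b & r] t).
  apply: runs_read; rewrite !topsE /= -/d.
  rewrite /d; case: (_ != _) => /=; last first.
    by apply: (runs_weaken (runs_skip _)).
  exact: (run_push Err).
have tr := runs_seq (@run_transfer X X' _ t isT) (@run_transfer Y Y' _ t isT).
have := runs_while_loop p (runs_seq rd (tr _)) rm.
have revE (z z' : seq G) : rev (behead z) ++ take 1 z ++ z' = rev z ++ z'.
  by case: z => //= u z; rewrite take0 rev_cons cat_rcons.
rewrite !revE catA -nseqD => H; apply: runs_weaken H _; lia.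
Qed.

Definition compare : Cmd :=
  Seq compare_loop (Seq (move_all (Rg X') (Rg X)) (move_all (Rg Y') (Rg Y))).

Lemma run_compare x y l b r t :
  exists m, [/\ (m == 0) = (x == y), m <= size x + size y &
    runs compare (memory [:: x, y, [::], [::], [::], l, b & r] t)
      ((size x + size y) * 17 + 3)
      (memory [:: x, y, [::], [::], nseq m sep, l, b & r] t)].
Proof.
have [m [Em lem rm]] := run_compare_loop x y [::] [::] [::] l b r t.
exists m; split=> //.
have := runs_seq rm (runs_seq (@run_move_all X' X _ t isT)
                              (@run_move_all Y' Y _ t isT)).
rewrite /= !cats0 !revK !size_rev => H; apply: runs_weaken H _; lia.
Qed.

Lemma memory_nth r r' t : nth [::] r =1 nth [::] r' -> memory r t = memory r' t.
Proof. by move=> E; apply/funext=> -[i|//] /=; rewrite E. Qed.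

Definition non_empty i : pred (view V G) := fun a => a (Rg i) != None.

Definition restore_loop i k : Cmd :=
  While (non_empty i) (Seq (pull i Y) (store_entry Y k)).

(** An entry costs [5 * N + 2] to pull, [5 * N + 3] to store and 1 for the test. The order of the
    entries is reversed. *)
Lemma run_restore_loop i k L L' r t N :
  i != k -> i != Y -> k != Y ->
  (forall g, g \in L -> fsize g <= N) ->
  nth [::] r i = lstr L -> nth [::] r Y = [::] -> nth [::] r k = lstr L' ->
  runs (restore_loop i k) (memory r t) (size L * (10 * N + 6)).+1
    (memory (set_nth [::] (set_nth [::] r i [::]) k (lstr (rev L ++ L'))) t).
Proof.
move=> ik iY kY.
have [kYn iYn] : (k == 1 :> nat) = false /\ (i == 1 :> nat) = false.
  by split; apply/negbTE.
have [ikn kin] : (i == k :> nat) = false /\ (k == i :> nat) = false.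
  by split; apply/negbTE => //; rewrite eq_sym.
elim: L L' r => [|g L IH] L' r LN Ei EY Ek.
  have := @runs_while_done _ _ (non_empty i) (Seq (pull i Y) (store_entry Y k))
    (memory r t).
  rewrite /non_empty topsE /= Ei => /(_ isT).
  congr (runs _ _ _ _); apply: memory_nth => a; rewrite !nth_set_nth /= nth_set_nth /=.
  by case: eqP => [->//|_]; case: eqP => [->|].
have p : non_empty i (tops (memory r t)).
  by rewrite /non_empty topsE /= Ei lstr_nil_eq.
have gN : fsize g <= N by apply: LN; rewrite mem_head.
have := @run_pull i Y (fstr g) (lstr L) r t iY.
rewrite Ei lstr_cons EY cats0 => /(_ erefl (sep_fstr g)) r1.
set ra := set_nth [::] (set_nth [::] r i (lstr L)) Y (rev (fstr g)) in r1.
have raY : nth [::] ra Y = rev (fstr g) by rewrite /ra nth_set_nth.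
have rak : nth [::] ra k = lstr L'.
  by rewrite /ra nth_set_nth /= kYn nth_set_nth /= kin.
have := runs_seq r1 (run_store_entry ra t kY).
rewrite raY rak revK -lstr_cons size_rev size_fstr.
set rb := set_nth [::] (set_nth [::] ra Y [::]) k _ => r2.
have rbE a : nth [::] rb a = if a == k then lstr (g :: L') else
    if a == Y then [::] else if a == i then lstr L else nth [::] r a.
  rewrite /rb nth_set_nth /=; case: eqP => // _.
  rewrite nth_set_nth /=; case: eqP => [//|/eqP/negbTE aY].
  by rewrite /ra nth_set_nth /= aY nth_set_nth.
have r3 : runs (restore_loop i k) (memory rb t) (size L * (10 * N + 6)).+1
    (memory (set_nth [::] (set_nth [::] rb i [::]) k (lstr (rev L ++ g :: L'))) t).
  apply: IH => [h hL||| ]; first by apply: LN; rewrite inE hL orbT.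
  - by rewrite rbE /= ikn iYn eqxx.
  - by rewrite rbE /= eq_sym kYn.
  - by rewrite rbE eqxx.
have := runs_while_loop p r2 r3; rewrite rev_cons cat_rcons => H.
have {}H := runs_weaken H (_ : _ <= (size (g :: L) * (10 * N + 6)).+1).
have := H _; rewrite (_ : memory (set_nth [::] (set_nth [::] rb i [::]) k _) t =
  memory (set_nth [::] (set_nth [::] r i [::]) k (lstr (rev L ++ g :: L'))) t).
  by apply; rewrite /= mulSn; lia.
apply: memory_nth => a; rewrite !nth_set_nth /= !nth_set_nth /=.
have [//|ak] := boolP (a == k :> nat); have [//|ai] := boolP (a == i :> nat).
by rewrite rbE (negbTE ak) (negbTE ai); case: eqP => [->|//]; rewrite EY.
Qed.

(** * Removal of one occurrence from a list *)

Section Remove.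
Variables (u : 'I_14) (j : nat).
(** The working registers 0 to 6 are written out in the statements, so the list sits at position [j]
    of the remaining ones. *)
Hypothesis uE : u = 7 + j :> nat.

(** The flag [Fo] restricts removal to the first occurrence, as [rem] does; the multiset of
    predecessors must lose just one. *)
Definition remove_loop : Cmd :=
  While (non_empty u) (Seq (pull u Y) (Seq compare (Read (fun a =>
    if (a (Rg Err) == None) && (a (Rg Fo) == None)
    then Seq (drop_while predT (Rg Y)) (Push (Rg Fo) sep)
    else Seq (drop_while predT (Rg Err)) (store_entry Y Li))))).

Definition mark (b : bool) : seq G := if b then [:: sep] else [::].

(** [b] records that the occurrence was found earlier; then the rest is copied unchanged. Entries
    are collected in reverse order, which [restore_loop] undoes. *)
Lemma run_remove_loop f L L' b N r t :
  fsize f <= N -> (forall g, g \in L -> fsize g <= N) ->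
  nth [::] r j = lstr L ->
  runs remove_loop
    (memory [:: rev (fstr f), [::], [::], [::], [::], lstr L', mark b & r] t)
    (size L * (60 * N + 20)).+1
    (memory [:: rev (fstr f), [::], [::], [::], [::],
       lstr (rev (if b then L else rem f L) ++ L'), mark (b || (f \in L))
       & set_nth [::] r j [::]] t).
Proof.
move=> fN; elim: L L' b r => [|g L IH] L' b r LN Er.
  rewrite orbF if_same; have := @runs_while_done _ _ (non_empty u).
  rewrite (@memory_nth (_ :: _) [:: rev (fstr f), [::], [::], [::], [::], lstr L',
    mark b & r]) => [H|]; last first.
    move=> k; do 7!(case: k => [//|k] /=).
    by rewrite nth_set_nth /=; case: eqP => // ->.
  by apply: H; rewrite /non_empty topsE /= uE /= Er.
have gN : fsize g <= N by apply: LN; rewrite mem_head.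
have p : non_empty u (tops (memory [:: rev (fstr f), [::], [::], [::], [::],
    lstr L', mark b & r] t)).
  by rewrite /non_empty topsE /= uE /= Er lstr_nil_eq.
have uY : u != Y by rewrite -val_eqE /= uE.
have r1 := @run_pull u Y (fstr g) (lstr L) [:: rev (fstr f), [::], [::], [::], [::],
    lstr L', mark b & r] t uY.
move: r1; rewrite uE /= => /(_ _ (sep_fstr g)).
rewrite Er lstr_cons => /(_ erefl); rewrite cats0 => r1.
set r' := set_nth _ _ _ _ in r1.
have [m [Em lem r2]] := run_compare (rev (fstr f)) (rev (fstr g)) (lstr L') (mark b) r' t.
have Efg : (m == 0) = (g == f).
  by rewrite Em (inj_eq (can_inj revK)) (inj_eq fstr_inj) eq_sym.
have Er' : nth [::] r' j = lstr L by rewrite nth_set_nth /= eqxx.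
have step b' L1 : (b', L1) = (if (g == f) && ~~ b then (true, L') else (b, g :: L')) ->
    runs (Read (fun a =>
    if (a (Rg Err) == None) && (a (Rg Fo) == None)
    then Seq (drop_while predT (Rg Y)) (Push (Rg Fo) sep)
    else Seq (drop_while predT (Rg Err)) (store_entry Y Li)))
    (memory [:: rev (fstr f), rev (fstr g), [::], [::], nseq m sep, lstr L', mark b & r'] t)
    (10 * N + 10)
    (memory [:: rev (fstr f), [::], [::], [::], [::], lstr L1, mark b' & r'] t).
  rewrite !size_rev !size_fstr in lem.
  move=> E1; apply: (@runs_weaken _ _ _ _ (10 * N + 9).+1); last by lia.
  apply: runs_read; rewrite !topsE /=.
  have -> : (ohead (nseq m sep) == None) = (g == f) by rewrite -Efg; case: (m).
  have -> : (ohead (mark b) == None) = ~~ b by case: (b).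
  move: E1; case: ifP => [/andP[gf bF]|_] [-> ->].
    have m0 : m = 0 by apply/eqP; rewrite Efg.
    have := runs_seq (@run_clear Y _ t) (@run_push Fo sep _ t).
    move=> /(_ [:: rev (fstr f), rev (fstr g), [::], [::], nseq m sep, lstr L',
                 mark b & r']).
    rewrite /= m0 (negbTE bF) size_rev size_fstr => H; apply: runs_weaken H _; lia.
  have := runs_seq (@run_clear Err _ t) (@run_store_entry Y Li _ t isT).
  move=> /(_ [:: rev (fstr f), rev (fstr g), [::], [::], nseq m sep, lstr L',
               mark b & r']).
  rewrite /= size_nseq size_rev revK -lstr_cons size_fstr => H.
  apply: runs_weaken H _; lia.
have [b' [L1 E1]] : exists b' L1,
    (b', L1) = (if (g == f) && ~~ b then (true, L') else (b, g :: L')).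
  by case: ifP => _; [exists true, L'|exists b, (g :: L')].
have r3 := step _ _ E1.
have r4 := IH L1 b' r' (fun h hL => LN h (@mem_behead _ (g :: L) h hL)) Er'.
have := runs_while_loop p (runs_seq r1 (runs_seq r2 r3)) r4.
have -> : rev (if b' then L else rem f L) ++ L1 =
          rev (if b then g :: L else rem f (g :: L)) ++ L'.
  move: E1 => /=; case: (g =P f) => [->|_] /=; case: (b) => -[-> ->] /=;
    by rewrite ?rev_cons ?cat_rcons.
have -> : b' || (f \in L) = b || (f \in g :: L).
  by move: E1; rewrite inE eq_sym; case: (f == g); case: (b) => -[-> _].
rewrite set_set_nth eqxx => H; apply: runs_weaken H _.
rewrite !size_rev !size_fstr mulSn; lia.
Qed.

Definition remove : Cmd := Seq remove_loop (restore_loop Li u).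

Definition remove_time N := N * (60 * N + 20) + N * (10 * N + 6) + 2.

Lemma run_remove f L N r t :
  fsize f <= N -> lsize L <= N -> nth [::] r j = lstr L ->
  runs remove
    (memory [:: rev (fstr f), [::], [::], [::], [::], [::], [::] & r] t)
    (remove_time N)
    (memory [:: rev (fstr f), [::], [::], [::], [::], [::], mark (f \in L)
       & set_nth [::] r j (lstr (rem f L))] t).
Proof.
move=> fN LN Erj.
have gN g : g \in L -> fsize g <= N.
  by move=> /fsize_lt_lsize/ltnW/leq_trans; apply.
have r1 := @run_remove_loop f L [::] false N r t fN gN Erj.
have Lu : Li != u by rewrite -val_eqE /= uE.
have uY : u != Y by rewrite -val_eqE /= uE.
have gN' g : g \in rev (rem f L) -> fsize g <= N.
  by rewrite mem_rev => /mem_rem/gN.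
have := @run_restore_loop Li u (rev (rem f L)) [::] [:: rev (fstr f), [::], [::], [::],
  [::], lstr (rev (rem f L)), mark (f \in L) & set_nth [::] r j [::]] t N
  Lu isT uY gN' erefl erefl.
rewrite uE /= nth_set_nth /= eqxx => /(_ erefl).
rewrite revK !cats0 set_set_nth eqxx => r2.
rewrite /= cats0 in r1.
have := runs_seq r1 r2 => H; apply: runs_weaken H _; rewrite /remove_time.
have sL : size L <= N by apply: leq_trans LN; apply: size_le_lsize.
have sL' : size (rev (rem f L)) <= N.
  by rewrite size_rev; apply: leq_trans sL; apply/size_subseq/rem_subseq.
have := leq_mul sL (leqnn (60 * N + 20)).
have := leq_mul sL' (leqnn (10 * N + 6)).
move: (60 * N + 20) (10 * N + 6) (size _) (size _) => a b c d; lia.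
Qed.

End Remove.
End Registers.

(** * Examining a formula *)

Section Greedy.
Variable M : turing_machine symbol.

Local Notation V := (stack_name M 14).
Local Notation G := (letter M).
Local Notation Rg i := (inl i : V).
Local Notation X := (@Ordinal 14 0 isT).
Local Notation Y := (@Ordinal 14 1 isT).
Local Notation Li := (@Ordinal 14 5 isT).
Local Notation Fo := (@Ordinal 14 6 isT).
Local Notation In := (@Ordinal 14 7 isT).
Local Notation A := (@Ordinal 14 8 isT).
Local Notation B := (@Ordinal 14 9 isT).
Local Notation S := (@Ordinal 14 10 isT).
Local Notation Cu := (@Ordinal 14 11 isT).
Local Notation Q := (@Ordinal 14 12 isT).
Local Notation Re := (@Ordinal 14 13 isT).
Local Notation Cmd := (cmd V G).
Local Notation sep := (Sy M sSep).
Local Notation memory := (@memory M 14).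
Local Notation lstr := (lstr M).
Local Notation fstr := (fstr M).
Local Notation mark := (mark M).
Local Notation non_empty := (@non_empty M).

Definition blank_tapes : 'I_(tm_tapes M).+1 -> tape (tm_symbol M) :=
  fun=> ([::], [::]).

(* Formula in hand, flag, input, candidates of this pass and of the next one,
   multiset of predecessors, current set, verdict. *)
Definition state (x fo inp a b s c res : seq G) : store V G :=
  memory [:: x; [::]; [::]; [::]; [::]; [::]; fo; inp; a; b; s; c; [::]; res]
    blank_tapes.

Definition feed (z : G) : G :=
  if z is inl s then Cell (Some (tm_input M s)) else z.

Definition sat_call : Cmd :=
  Seq (move_all (Rg Cu) (Rg Li))
 (Seq (move_copy feed (Rg Li) (Rg Cu) (inr (ord0, true)))
      (run_machine M Q Re)).

Definition sat_time N T := 13 * N + 2 + machine_time M N T.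

Lemma leq_machine_time l l' T : l <= l' -> machine_time M l T <= machine_time M l' T.
Proof.
move=> le; rewrite /machine_time !(leq_add2l, leq_add2r) ltnS leq_mul2l.
by apply/orP; right; lia.
Qed.

Implicit Types (f : formula) (L La Lb Ls : seq formula).

Lemma run_sat_call x fo inp a b s L N T v :
  lsize L <= N ->
  tm_halts_within M (enc_list enc_formula L) T v ->
  runs sat_call (state x fo inp a b s (lstr L) [::]) (sat_time N T)
    (state x fo inp a b s (lstr L) (if v then [:: Sy M sTop] else [::])).
Proof.
move=> LN Hv; set r0 := [:: x; [::]; [::]; [::]; [::]; [::]; fo; inp; a; b; s;
  lstr L; [::]; [::]].
have r1 := @run_move_all M Cu Li r0 blank_tapes isT.
have r2 q := @runs_move_copy V G feed (Rg Li) (Rg Cu) (inr (ord0, true)) q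
   isT isT isT.
move: r1; rewrite /= cats0 => r1.
have := r2 (memory [:: x; [::]; [::]; [::]; [::]; rev (lstr L); fo; inp; a; b; s;
  [::]; [::]; [::]] blank_tapes).
rewrite /= !cats0 revK size_rev !memory_upd /=.
have -> : [seq feed i | i <- lstr L] =
   map (@Cell M) [seq Some (tm_input M z) | z <- enc_list enc_formula L].
  by rewrite -!map_comp; apply: eq_map.
rewrite memory_updr /= => {}r2.
have Et : fupd blank_tapes ord0 ((blank_tapes ord0).1,
    [seq Some (tm_input M z) | z <- enc_list enc_formula L]) =
    input_tapes (enc_list enc_formula L).
  by apply/funext=> i; rewrite /fupd /input_tapes; case: eqP.
rewrite Et in r2.
have r3 := @runs_run_machine M 14 Q Re isT [:: x; [::]; [::]; [::]; [::]; [::]; fo; inp;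
  a; b; s; lstr L; [::]; [::]] _ _ _ erefl erefl Hv.
have := runs_seq r1 (runs_seq r2 r3); move=> H; apply: runs_weaken H _.
rewrite /sat_time size_map -/(lsize L).
by have := leq_machine_time T LN; lia.
Qed.

(** A formula found in the current list is only moved to its front, without a call. A new one is put
    in front tentatively and taken off again if the call rejects. *)
Definition process : Cmd :=
  Seq (remove M Cu) (Seq (store_entry M X Cu) (Read (fun a =>
    if non_empty Fo a then Pop (Rg Fo)
    else Seq sat_call (Read (fun a =>
      if non_empty Re a then Pop (Rg Re)
      else Seq (drop_while (predC1 sep) (Rg Cu)) (Pop (Rg Cu))))))).

Definition add_formula (v : bool) f (L : seq formula) :=
  if f \in L then f :: rem f L else if v then f :: L else L.

Definition process_time N T := remove_time N + sat_time N T + 10 * N + 10.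

Lemma run_process f inp a b s L N T v :
  lsize (f :: L) <= N ->
  (f \notin L -> tm_halts_within M (enc_list enc_formula (f :: L)) T v) ->
  runs process (state (rev (fstr f)) [::] inp a b s (lstr L) [::])
    (process_time N T)
    (state [::] [::] inp a b s (lstr (add_formula v f L)) [::]).
Proof.
rewrite lsize_cons => LN Hv.
have [fN LN'] : fsize f <= N /\ lsize L <= N by lia.
have r1 := @run_remove M Cu 4 erefl f L N [:: inp; a; b; s; lstr L; [::]; [::]]
   blank_tapes fN LN' erefl.
have r0 q := @run_store_entry M X Cu q blank_tapes isT.
have := r0 ([:: rev (fstr f); [::]; [::]; [::]; [::]; [::]; mark (f \in L); inp; a; b; s;
   lstr (rem f L); [::]; [::]]).
rewrite /= revK -lstr_cons size_rev size_fstr => r2.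
suff [T' [leT r3]] : exists T', T' <= sat_time N T + 3 * N + 5 /\
   runs (Read (fun a =>
    if non_empty Fo a then Pop (Rg Fo)
    else Seq sat_call (Read (fun a =>
      if non_empty Re a then Pop (Rg Re)
      else Seq (drop_while (predC1 sep) (Rg Cu)) (Pop (Rg Cu))))))
    (state [::] (mark (f \in L)) inp a b s (lstr (f :: rem f L)) [::]) T'
    (state [::] [::] inp a b s (lstr (add_formula v f L)) [::]).
  have := runs_seq r1 (runs_seq r2 r3) => H; apply: runs_weaken H _.
  rewrite /process_time; lia.
rewrite /add_formula; have [fL|fL] := boolP (f \in L).
  exists 2; split; first by lia.
  apply: runs_read; rewrite /non_empty topsE /=.
  exact: (@run_pop M Fo).
have H1 : lsize (f :: L) <= N by rewrite lsize_cons.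
have := @run_sat_call [::] [::] inp a b s (f :: L) N T v H1 (Hv fL).
rewrite rem_id // => r4.
exists (sat_time N T + (2 * N + 3).+1).+1; split; first by lia.
apply: runs_read; rewrite /non_empty topsE /=.
apply: runs_seq r4 _; apply: runs_read; rewrite /non_empty topsE /=.
case: (v) => /=.
  have := @run_pop M Re [:: [::]; [::]; [::]; [::]; [::]; [::]; [::]; inp; a; b; s;
    lstr (f :: L); [::]; [:: Sy M sTop]] blank_tapes.
  by move=> /= H; apply: runs_weaken H _; lia.
have := @runs_drop _ _ (predC1 sep) (Rg Cu) (state [::] [::] inp a b s (lstr (f :: L)) [::])
  (fstr f) (sep :: lstr L) (lstr_cons _ _ _) (sep_fstr _ _) isT.
rewrite memory_upd /= => r5.
have := runs_seq r5 (run_pop Cu _ _) => /= H; apply: runs_weaken H _.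
rewrite size_fstr; lia.
Qed.

Definition examine : Cmd :=
  Seq (pull M A X) (Seq (remove M S) (Read (fun a =>
    if non_empty Fo a then Seq (Pop (Rg Fo)) (store_entry M X B)
    else process))).

Definition examine_time N T := remove_time N + process_time N T + 10 * N + 10.

Lemma run_examine_defer f inp La Lb Ls L N T :
  fsize f <= N -> lsize Ls <= N -> f \in Ls ->
  runs examine (state [::] [::] inp (lstr (f :: La)) (lstr Lb) (lstr Ls) (lstr L) [::])
    (examine_time N T)
    (state [::] [::] inp (lstr La) (lstr (f :: Lb)) (lstr (rem f Ls)) (lstr L) [::]).
Proof.
move=> fN LsN fS.
have := @run_pull M A X (fstr f) (lstr La) [:: [::]; [::]; [::]; [::]; [::]; [::]; [::];
   inp; lstr (f :: La); lstr Lb; lstr Ls; lstr L; [::]; [::]] blank_tapes isT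
   (lstr_cons _ _ _) (sep_fstr _ _).
rewrite /= cats0 size_fstr => r1.
have r2 := @run_remove M S 3 erefl f Ls N [:: inp; lstr La; lstr Lb; lstr Ls; lstr L; [::];
   [::]] blank_tapes fN LsN erefl.
rewrite fS /= in r2.
have r3 := runs_seq (@run_pop M Fo [:: rev (fstr f); [::]; [::]; [::]; [::]; [::];
   [:: sep]; inp; lstr La; lstr Lb; lstr (rem f Ls); lstr L; [::]; [::]] blank_tapes)
  (@run_store_entry M X B _ blank_tapes isT).
rewrite /= revK -lstr_cons size_rev size_fstr in r3.
suff r4 : runs (Read (fun a =>
    if non_empty Fo a then Seq (Pop (Rg Fo)) (store_entry M X B)
    else process)) (state (rev (fstr f)) [:: sep] inp (lstr La) (lstr Lb) (lstr (rem f Ls))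
     (lstr L) [::]) (1 + (fsize f * 5).+3).+1
   (state [::] [::] inp (lstr La) (lstr (f :: Lb)) (lstr (rem f Ls)) (lstr L) [::]).
  have := runs_seq r1 (runs_seq r2 r4) => H; apply: runs_weaken H _.
  rewrite /examine_time; lia.
by apply: runs_read; rewrite /non_empty topsE.
Qed.

Lemma run_examine_process f inp La Lb Ls L N T v :
  fsize f <= N -> lsize Ls <= N -> f \notin Ls ->
  lsize (f :: L) <= N ->
  (f \notin L -> tm_halts_within M (enc_list enc_formula (f :: L)) T v) ->
  runs examine (state [::] [::] inp (lstr (f :: La)) (lstr Lb) (lstr Ls) (lstr L) [::])
    (examine_time N T)
    (state [::] [::] inp (lstr La) (lstr Lb) (lstr Ls) (lstr (add_formula v f L)) [::]).
Proof.
move=> fN LsN fS LN Hv.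
have := @run_pull M A X (fstr f) (lstr La) [:: [::]; [::]; [::]; [::]; [::]; [::]; [::];
   inp; lstr (f :: La); lstr Lb; lstr Ls; lstr L; [::]; [::]] blank_tapes isT
   (lstr_cons _ _ _) (sep_fstr _ _).
rewrite /= cats0 size_fstr => r1.
have r2 := @run_remove M S 3 erefl f Ls N [:: inp; lstr La; lstr Lb; lstr Ls; lstr L; [::];
   [::]] blank_tapes fN LsN erefl.
rewrite (negbTE fS) rem_id //= in r2.
have r3 := @run_process f inp (lstr La) (lstr Lb) (lstr Ls) L N T v LN Hv.
suff r4 : runs (Read (fun a =>
    if non_empty Fo a then Seq (Pop (Rg Fo)) (store_entry M X B)
    else process)) (state (rev (fstr f)) [::] inp (lstr La) (lstr Lb) (lstr Ls)
     (lstr L) [::]) (process_time N T).+1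
   (state [::] [::] inp (lstr La) (lstr Lb) (lstr Ls) (lstr (add_formula v f L)) [::]).
  have := runs_seq r1 (runs_seq r2 r4) => H; apply: runs_weaken H _.
  rewrite /examine_time; lia.
by apply: runs_read; rewrite /non_empty topsE.
Qed.

End Greedy.

(** * The invariant of the greedy loop *)

Lemma lsize_perm L L' : perm_eq L L' -> lsize L = lsize L'.
Proof.
move=> p; rewrite /lsize /enc_list !size_flatten /shape -!map_comp !sumnE.
exact/perm_big/perm_map.
Qed.

Lemma lsize_rem f L : lsize (rem f L) <= lsize L.
Proof.
have [fL|fL] := boolP (f \in L); last by rewrite rem_id.
rewrite [leqRHS](lsize_perm (perm_to_rem fL)) lsize_cons; lia.
Qed.

Section Progress.
Variables (fs W : seq formula) (prec : rel formula) (rank : formula -> nat).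
(** Bounds the code length of the current list plus the pending formulas. The sum never grows, since
    an accepted formula leaves the pending ones, so every list to be tested in the loop has length
    at most [K0]. *)
Variable K0 : nat.
Hypothesis fs_uniq : uniq fs.
Hypothesis prec_rank : forall g f, prec g f -> rank g < rank f.
Hypothesis prec_total : forall g f, g \in fs -> f \in fs -> g != f ->
  prec g f || prec f g.

Implicit Types (La Lb Ls pr acc cur : seq formula).

(* During pass [k], [La] still has to be examined and [Lb] has been deferred;
   [pr] is processed and [acc] accepted. *)
Record progress (k : nat) (La Lb Ls pr acc cur : seq formula) : Prop := Progress {
  progress_perm : perm_eq (pr ++ La ++ Lb) fs;
  progress_pending : forall f, f \in La -> count_mem f Ls + k = rank f;
  progress_deferred : forall f, f \in Lb -> count_mem f Ls + k.+1 = rank f;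
  progress_rank : forall f, f \in pr -> rank f <= k;
  progress_cur_uniq : uniq cur;
  progress_cur : cur =i W ++ acc;
  progress_acc : {subset acc <= pr};
  progress_rejected : forall f, f \in pr -> f \notin acc ->
    ~ satisfiable (f |` [set` W] `|` [set g | g \in acc /\ prec g f]);
  progress_sat : satisfiable [set` W] -> satisfiable [set` W ++ acc];
  progress_size : lsize cur + (lsize La + lsize Lb) <= K0 }.

Lemma count_rem (f g : formula) L :
  f \in L -> count_mem g (rem f L) + (f == g) = count_mem g L.
Proof. by move=> /perm_to_rem/permP/(_ (pred1 g)) -> /=; rewrite addnC. Qed.

Lemma progress_uniq k La Lb Ls pr acc cur :
  progress k La Lb Ls pr acc cur -> uniq (pr ++ La ++ Lb).
Proof. by case=> /perm_uniq ->. Qed.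

(** [f] trades one occurrence in [Ls] for one later pass, so the sum equal to its rank is kept. It
    is listed only once, so the other pending formulas differ from it and keep their counts. *)
Lemma progress_defer k f La Lb Ls pr acc cur : f \in Ls ->
  progress k (f :: La) Lb Ls pr acc cur ->
  progress k La (f :: Lb) (rem f Ls) pr acc cur.
Proof.
move=> fLs H; have := progress_uniq H.
rewrite cat_uniq => /and3P[_ _ /= /andP[+ _]].
rewrite mem_cat negb_or => /andP[fLa fLb].
case: H => p HA HB Hr cu cE as_ rej sat sz; split=> //.
- apply: perm_trans p; rewrite perm_cat2l -cat1s perm_catCA //.
- move=> g gLa; have := HA g; rewrite inE gLa orbT => /(_ isT) <-.
  rewrite -(count_rem g fLs); case: eqP gLa fLa => [->->//|_ _ _]; lia.
- move=> g; rewrite inE => /predU1P[->|gLb].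
    have := HA f; rewrite mem_head => /(_ isT) <-.
    by rewrite -(count_rem f fLs) eqxx; lia.
  have := HB g gLb; rewrite -(count_rem g fLs).
  by case: eqP gLb fLb => [->->//|_ _ _]; lia.
- by move: sz; rewrite !lsize_cons; lia.
Qed.

(** With no occurrence left, [f] has rank [k], while processed formulas have rank at most [k]; by
    totality all accepted formulas precede [f]. So a failed test of the whole list yields the
    inconsistency demanded of a rejected formula. *)
Lemma progress_process k f La Lb Ls pr acc cur (v : bool) : f \notin Ls ->
  progress k (f :: La) Lb Ls pr acc cur ->
  (f \notin cur -> (v <-> satisfiable [set` f :: cur])) ->
  exists acc', progress k La Lb Ls (f :: pr) acc' (add_formula v f cur).
Proof.
move=> fLs H Hv; have U := progress_uniq H.
case: H => p HA HB Hr cu cE as_ rej sat sz.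
have rf : rank f = k by rewrite -HA ?mem_head // (count_memPn fLs).
have ffs : f \in fs by rewrite -(perm_mem p) !mem_cat mem_head orbT.
have fpr : f \notin pr.
  by move: U; rewrite cat_uniq /= negb_or => /and3P[_ /andP[]].
have before g : g \in acc -> prec g f.
  move=> /as_ gpr; have gfs : g \in fs by rewrite -(perm_mem p) mem_cat gpr.
  have gf : g != f by apply: contraNneq fpr => <-.
  case/orP: (prec_total gfs ffs gf) => // /prec_rank.
  by rewrite rf ltnNge Hr.
pose ok := (f \in cur) || v.
exists (if ok then f :: acc else acc).
have p' : perm_eq ((f :: pr) ++ La ++ Lb) fs.
  by apply: perm_trans p; rewrite -[f :: pr]cat1s -catA perm_catCA.
split=> //.
- by move=> g gLa; apply: HA; rewrite inE gLa orbT.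
- by move=> g; rewrite inE => /predU1P[->|/Hr//]; rewrite rf.
- rewrite /add_formula; case: ifP => fcur /=; last by case: ifP => // _; rewrite /= fcur.
  by rewrite mem_rem_uniq // inE eqxx /= rem_uniq.
- rewrite /add_formula /ok => g; case: ifP => fcur /=; last first.
    by case: ifP => _ //; rewrite mem_cat !inE orbCA -mem_cat cE.
  rewrite inE mem_rem_uniq // inE mem_cat inE orbCA -mem_cat -cE.
  by case: eqP.
- move=> g; rewrite [g \in _ :: pr]inE; case: ifP => _; last first.
    by move=> /as_ ->; rewrite orbT.
  by rewrite inE => /predU1P[->|/as_ ->]; rewrite ?eqxx ?orbT.
- move=> g; rewrite inE => /predU1P[->|gpr].
    rewrite /ok; case: ifP => [_|/negbT]; first by rewrite mem_head.
    rewrite negb_or => /andP[fcur /negP nv] facc.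
    apply: contra_not nv => /satisfiable_mono H; apply/(Hv fcur); apply: H.
    move=> h /=; rewrite inE cE mem_cat => /or3P[/eqP->|hW|hacc].
    + by left; left.
    + by left; right.
    + by right; split=> //; apply: before.
  move=> gacc; have ga : g \notin acc.
    by move: gacc; case: ifP => // _; rewrite inE negb_or => /andP[].
  move=> /satisfiable_mono H; apply: (rej _ gpr ga); apply: H.
  move=> h [|[hacc hg]]; [by left|right; split=> //].
  by case: ifP => // _; rewrite inE hacc orbT.
- move=> /sat satacc; rewrite /ok; case: ifP => [|_ //].
  (* A formula already present leaves the set as it was; for a new one the successful test gives the
     model. *)
  case: (boolP (f \in cur)) => [fcur _|fcur /= /(Hv fcur)].
    apply: satisfiable_mono satacc => g /=.
    by rewrite !mem_cat inE orbCA -mem_cat -cE => /predU1P[->|].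
  by apply: satisfiable_mono => g /=; rewrite mem_cat !inE orbCA -mem_cat cE.
- rewrite lsize_cons in sz; rewrite /add_formula; case: ifP => fcur.
    by rewrite -(lsize_perm (perm_to_rem fcur)); lia.
  by case: ifP => _; rewrite ?lsize_cons; lia.
Qed.

(** The reversal comes from [restore_loop]; the invariant does not depend on the order inside a
    pass. *)
Lemma progress_next_pass k Lb Ls pr acc cur :
  progress k [::] Lb Ls pr acc cur ->
  progress k.+1 (rev Lb) [::] Ls pr acc cur.
Proof.
case=> p HA HB Hr cu cE as_ rej sat sz; split=> //.
- by apply: perm_trans p; rewrite perm_cat2l cats0 /= perm_rev.
- by move=> f; rewrite mem_rev; apply: HB.
- by move=> f /Hr; lia.
- rewrite (lsize_perm (_ : perm_eq (rev Lb) Lb)) ?perm_rev //.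
  by move: sz; rewrite /=; lia.
Qed.

End Progress.

(** * The greedy loop *)

Section Loop.
Variables (M : turing_machine symbol) (fs W : seq formula).
Variables (prec : rel formula) (rank : formula -> nat) (N T : nat).
Hypothesis fs_uniq : uniq fs.
Hypothesis prec_rank : forall g f, prec g f -> rank g < rank f.
Hypothesis prec_total : forall g f, g \in fs -> f \in fs -> g != f ->
  prec g f || prec f g.
Hypothesis M_decides : forall L, uniq L -> {subset L <= W ++ fs} -> lsize L <= N ->
  exists v, tm_halts_within M (enc_list enc_formula L) T v /\
            (v <-> satisfiable [set` L]).

Local Notation A := (@Ordinal 14 8 isT).
Local Notation B := (@Ordinal 14 9 isT).
Local Notation non_empty := (@non_empty M).
Local Notation lstr := (lstr M).
Local Notation state := (@state M [::] [::]).
Local Notation progress := (progress fs W prec rank N).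

Implicit Types (La Lb Ls pr acc cur : seq formula).

Definition pass := While (non_empty A) (examine M).

(** Every examination lowers the total of the three list lengths: deferring removes an occurrence
    from [Ls], processing removes a formula from [La]. *)
Lemma run_pass k La Ls pr acc cur inp :
  progress k La [::] Ls pr acc cur -> La != [::] -> lsize Ls <= N ->
  exists Lb Ls' pr' acc' cur',
    [/\ progress k [::] Lb Ls' pr' acc' cur', lsize Ls' <= N,
        size Lb + size Ls' < size La + size Ls &
        runs pass (state inp (lstr La) (lstr [::]) (lstr Ls) (lstr cur) [::])
          ((size La + size Ls) * (examine_time M N T).+1).+1
          (state inp (lstr [::]) (lstr Lb) (lstr Ls') (lstr cur') [::])].
Proof.
move=> H0 La0 LsN.
(* The equation is kept apart so that [m0] stays fixed while the lists vary in [J]. *)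
have [m0 m0E] : exists m0, m0 = size La + size Ls by exists (size La + size Ls).
rewrite -m0E.
(* The last conjunct says that an examination has taken place or is still due; once [La] is empty it
   gives the strict decrease that the outer loop needs. *)
pose J m s := exists La Lb Ls pr acc cur,
  [/\ progress k La Lb Ls pr acc cur,
      s = state inp (lstr La) (lstr Lb) (lstr Ls) (lstr cur) [::],
      m = size La + size Lb + size Ls, lsize Ls <= N &
      (m <= m0) && ((m < m0) || (La != [::]))].
have [||m' [s' [_ [L [Lb [Ls' [pr' [acc' [cur' [H -> -> LsN' le]]]]]]] nA r]]] :=
    @runs_while_inv _ _ J (non_empty A) (examine M) (examine_time M N T) m0
      (state inp (lstr La) (lstr [::]) (lstr Ls) (lstr cur) [::]); last 1 first.
- move: H le r; have -> : L = [::].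
    by move: nA; rewrite /non_empty topsE /= negbK lstr_nil_eq => /eqP.
  move=> H; rewrite orbF => /andP[_ lt] r.
  by exists Lb, Ls', pr', acc', cur'; split.
- move=> {La La0 Ls H0 LsN m0E pr acc cur} m s.
  move=> [[|f La] [Lb [Ls [pr [acc [cur [H -> -> LsN le]]]]]]].
    by rewrite /non_empty topsE.
  move=> _; have sz := progress_size H; rewrite lsize_cons in sz.
  have fN : fsize f <= N by lia.
  have cN : lsize (f :: cur) <= N by rewrite lsize_cons; lia.
  have [fLs|fLs] := boolP (f \in Ls).
    exists (size La + size (f :: Lb) + size (rem f Ls)).
    exists (state inp (lstr La) (lstr (f :: Lb)) (lstr (rem f Ls)) (lstr cur) [::]).
    have sLs : (size (rem f Ls)).+1 = size Ls.
      by rewrite size_rem // prednK //; case: (Ls) fLs.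
    have lt : size La + size (f :: Lb) + size (rem f Ls) <
              size (f :: La) + size Lb + size Ls.
      by rewrite -sLs /= addnS !addSn addnS.
    split=> //; last exact: run_examine_defer.
    exists La, (f :: Lb), (rem f Ls), pr, acc, cur; split=> //.
    - exact: progress_defer.
    - exact: leq_trans (lsize_rem _ _) LsN.
    - case/andP: le => le _; have lt' := leq_trans lt le.
      by rewrite lt' ltnW.
  have ffs : f \in fs.
    by rewrite -(perm_mem (progress_perm H)) !mem_cat mem_head orbT.
  have [v Hv] : exists v : bool, f \notin cur ->
      tm_halts_within M (enc_list enc_formula (f :: cur)) T v /\
      (v <-> satisfiable [set` f :: cur]).
    have [fc|fc] := boolP (f \in cur); first by exists true.
    have [v vP] : exists v, tm_halts_within M (enc_list enc_formula (f :: cur)) T v /\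
      (v <-> satisfiable [set` f :: cur]).
      apply: M_decides => //=; first by rewrite fc (progress_cur_uniq H).
      move=> g; rewrite inE mem_cat => /predU1P[->|]; first by rewrite ffs orbT.
      rewrite (progress_cur H) mem_cat => /orP[->//|/(progress_acc H) gpr].
      by rewrite -(perm_mem (progress_perm H)) mem_cat gpr orbT.
    by exists v.
  have [acc' H'] := progress_process fs_uniq prec_rank prec_total fLs H
                      (fun fc => proj2 (Hv fc)).
  exists (size La + size Lb + size Ls).
  exists (state inp (lstr La) (lstr Lb) (lstr Ls) (lstr (add_formula v f cur)) [::]).
  split; first by rewrite /=; lia.
    exists La, Lb, Ls, (f :: pr), acc', (add_formula v f cur); split=> //.
    by case/andP: le => /= le _; apply/andP; split; [|apply/orP; left]; lia.
  by apply: run_examine_process => // fc; case: (Hv fc).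
- by exists La, [::], Ls, pr, acc, cur; split=> //; rewrite ?addn0 // La0 orbT leqnn.
Qed.

Definition greedy_loop :=
  While (non_empty A) (Seq pass (restore_loop M B A)).

(** [2 * N] bounds formulas and occurrences together, hence the examinations of one pass. *)
Definition pass_time := (2 * N * (examine_time M N T).+1).+1 + (N * (10 * N + 6)).+1.

Lemma run_greedy_loop (Ls : seq formula) inp :
  {in fs, forall f, count_mem f Ls = rank f} ->
  uniq W -> lsize W + lsize fs <= N -> lsize Ls <= N ->
  exists acc cur, 
    [/\ {subset acc <= fs}, uniq cur, cur =i W ++ acc,
      forall f, f \in fs -> f \notin acc ->
        ~ satisfiable (f |` [set` W] `|` [set g | g \in acc /\ prec g f]) &
      satisfiable [set` W] -> satisfiable [set` W ++ acc]] /\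
    lsize cur <= N /\ exists s,
      runs greedy_loop (state inp (lstr fs) (lstr [::]) (lstr Ls) (lstr W) [::])
        (2 * N * pass_time.+1).+1
        (state inp (lstr [::]) (lstr [::]) s (lstr cur) [::]).
Proof.
move=> Hcount Wu sz LsN.
pose J m s := exists k La Ls pr acc cur,
  [/\ progress k La [::] Ls pr acc cur,
      s = state inp (lstr La) (lstr [::]) (lstr Ls) (lstr cur) [::],
      m = size La + size Ls, m <= 2 * N & lsize Ls <= N].
have [||m' [s' [_ [k [L [Ls' [pr [acc [cur [H -> _ _ _]]]]]]] nA r]]] :=
    @runs_while_inv _ _ J (non_empty A) (Seq pass (restore_loop M B A)) pass_time
      (size fs + size Ls)
      (state inp (lstr fs) (lstr [::]) (lstr Ls) (lstr W) [::]); last 1 first.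
- move: H r; have -> : L = [::].
    by move: nA; rewrite /non_empty topsE /= negbK lstr_nil_eq => /eqP.
  case; rewrite !cats0 => p _ _ _ cu cE as_ rej sat sz' r.
  exists acc, cur; split; [split=> //|].
  - by move=> f /as_; rewrite (perm_mem p).
  - by move=> f; rewrite -(perm_mem p); apply: rej.
  split; first by apply: leq_trans sz'; apply: leq_addr.
  exists (lstr Ls'); apply: runs_weaken r _.
  rewrite ltnS leq_mul2r; apply/orP; right.
  have := size_le_lsize fs; have := size_le_lsize Ls. lia.
- move=> m s [k [La [L [pr [acc [cur [H -> -> mN LN]]]]]]].
  rewrite /non_empty topsE /= lstr_nil_eq => La0.
  have [Lb [L' [pr' [acc' [cur' [H' LN' lt r1]]]]]] := run_pass inp H La0 LN.
  exists (size (rev Lb) + size L').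
  exists (state inp (lstr (rev Lb)) (lstr [::]) (lstr L') (lstr cur') [::]).
  split; first by rewrite size_rev.
    exists k.+1, (rev Lb), L', pr', acc', cur'; split=> //.
      exact: progress_next_pass.
    by rewrite size_rev; apply: leq_trans (ltnW lt) mN.
  have szb : lsize Lb <= N by have := progress_size H'; rewrite /=; lia.
  have gN g : g \in Lb -> fsize g <= N.
    by move=> /fsize_lt_lsize/ltnW/leq_trans; apply.
  have := @run_restore_loop M B A Lb [::]
    [:: [::]; [::]; [::]; [::]; [::]; [::]; [::]; inp; lstr [::]; lstr Lb; lstr L';
     lstr cur'; [::]; [::]] (@blank_tapes M) N isT isT isT gN erefl erefl erefl.
  rewrite cats0 /= => r2.
  have := runs_seq r1 r2 => H2; apply: runs_weaken H2 _.
  rewrite /pass_time leq_add // ltnS leq_mul //.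
  exact: leq_trans (size_le_lsize _) szb.
- exists 0, fs, Ls, [::], [::], W; split=> //.
    split=> //=; rewrite ?cats0 //.
    + by move=> f ffs; rewrite addn0 Hcount.
    + by move: sz; rewrite /lsize /=; lia.
  have := size_le_lsize fs; have := size_le_lsize Ls; lia.
Qed.

End Loop.

(** * The complete program *)

Section Main.
Variable M : turing_machine symbol.

Local Notation V := (stack_name M 14).
Local Notation G := (letter M).
Local Notation Rg i := (inl i : V).
Local Notation X := (@Ordinal 14 0 isT).
Local Notation In := (@Ordinal 14 7 isT).
Local Notation A := (@Ordinal 14 8 isT).
Local Notation B := (@Ordinal 14 9 isT).
Local Notation S := (@Ordinal 14 10 isT).
Local Notation Cu := (@Ordinal 14 11 isT).
Local Notation Re := (@Ordinal 14 13 isT).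
Local Notation Cmd := (cmd V G).
Local Notation sep := (Sy M sSep).
Local Notation memory := (@memory M 14).
Local Notation lstr := (lstr M).
Local Notation fstr := (fstr M).
Local Notation str := (str M).
Local Notation blank_tapes := (@blank_tapes M).
Implicit Types (f : formula) (r : seq (seq G)).

(** * Reading the instance *)

Definition skip_to (c : symbol) : Cmd :=
  Seq (drop_while (predC1 (Sy M c)) (Rg In)) (Pop (Rg In)).

Lemma run_skip_to c (w : seq symbol) z r t :
  c \notin w -> nth [::] r In = str w ++ Sy M c :: z ->
  runs (skip_to c) (memory r t) (size w * 2).+2 (memory (set_nth [::] r In z) t).
Proof.
move=> cw E.
have Ec : ~~ (if ohead (Sy M c :: z) is Some x then predC1 (Sy M c) x else false).
  by rewrite /= eqxx.
have Ew : all (predC1 (Sy M c)) (str w).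
  apply/allP=> y /mapP[x xw ->] /=; rewrite (inj_eq (@Sy_inj M)).
  by apply: contraNneq cw => <-.
have := @runs_drop _ _ _ (Rg In) (memory r t) _ _ E Ew Ec.
rewrite memory_upd size_map => r1.
have := runs_seq r1 (run_pop In _ t).
by rewrite nth_set_nth /= set_set_nth eqxx addn1.
Qed.

Section Load.
(** An item is a prefix discarded by [skip], then the one formula that is kept: the fact itself, the
    conclusion of a default, or the conclusion of the second default of a pair. *)
Variables (T : eqType) (pre : T -> seq symbol) (body : T -> formula).
Variables (skip : Cmd) (Tskip : nat).
Hypothesis skipP : forall x r t z, nth [::] r In = str (pre x) ++ z ->
  runs skip (memory r t) (Tskip * (size (pre x)).+1) (memory (set_nth [::] r In z) t).
Hypothesis preP : forall x, sBar \notin pre x.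

Definition item x := pre x ++ rcons (enc_formula (body x)) sSep.

Definition not_bar : pred (view V G) := fun a => a (Rg In) != Some (Sy M sBar).

Definition load (dst : 'I_14) : Cmd :=
  Seq (While not_bar (Seq skip (Seq (pull M In X) (store_entry M X dst))))
      (Pop (Rg In)).

(** Lists come out reversed, which is harmless for sets and multisets. *)
Lemma run_load dst (items : seq T) L z r t N :
  dst != X -> dst != In ->
  nth [::] r X = [::] -> nth [::] r dst = lstr L ->
  nth [::] r In = str (flatten (map item items)) ++ Sy M sBar :: z ->
  (forall x, x \in items -> size (item x) <= N) ->
  runs (load dst) (memory r t) (size items * ((Tskip + 10) * N.+1 + 6)).+2
    (memory (set_nth [::] (set_nth [::] r In z) dst
               (lstr (rev (map body items) ++ L))) t).
Proof.
move=> dX dI rX rd rI sN.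
have [dXn dIn] : (dst == 0 :> nat) = false /\ (dst == 7 :> nat) = false.
  by split; apply/negbTE.
have Xd : (0 == dst :> nat) = false by rewrite eq_sym.
have Id : (7 == dst :> nat) = false by rewrite eq_sym.
suff H : runs (While not_bar (Seq skip (Seq (pull M In X) (store_entry M X dst))))
    (memory r t) (size items * ((Tskip + 10) * N.+1 + 6)).+1
    (memory (set_nth [::] (set_nth [::] r In (Sy M sBar :: z)) dst
               (lstr (rev (map body items) ++ L))) t).
  have := runs_seq H (run_pop In _ t); rewrite addn1; congr (runs _ _ _ _).
  apply: memory_nth => a; rewrite !nth_set_nth /= !nth_set_nth /= !nth_set_nth /=.
  by rewrite Id /=; case: (boolP (a == 7)) => [/eqP->|_] //; rewrite Id.
elim: items L r rX rd rI sN => [|x items IH] L r rX rd rI sN.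
  have := @runs_while_done _ _ not_bar (Seq skip (Seq (pull M In X)
    (store_entry M X dst))) (memory r t).
  rewrite /not_bar topsE /= rI eqxx => /(_ isT); congr (runs _ _ _ _).
  apply: memory_nth => a; rewrite nth_set_nth /=.
  case: eqP => [->//|_]; rewrite nth_set_nth /=.
  by case: eqP => [->|].
(* An item never starts with [sBar], so one symbol tells another item from the end of the list. *)
have p : not_bar (tops (memory r t)).
  rewrite /not_bar topsE /= rI /= /item; case Ep: (pre x) => [|c w] /=.
    case Ef: (enc_formula _) => [|c w] //=.
    have := @enc_formula_sep (body x) c; rewrite Ef mem_head => /(_ isT).
    apply: contraNneq => -[->] //.
  by have := preP x; rewrite Ep inE negb_or => /andP[+ _]; apply: contraNneq => -[->].
have sx : size (item x) <= N by apply: sN; rewrite mem_head.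
have := sx; rewrite /item size_cat size_rcons => sx'.
set z1 := str (flatten (map item items)) ++ Sy M sBar :: z.
have E1 : nth [::] r In = str (pre x) ++ (fstr (body x) ++ sep :: z1).
  by rewrite rI /z1 /str /= !map_cat -!catA map_rcons cat_rcons.
have r1 := skipP t E1.
set ra := set_nth _ _ _ _ in r1.
have raI : nth [::] ra In = fstr (body x) ++ sep :: z1 by rewrite /ra nth_set_nth.
have r2 := @run_pull M In X _ _ ra t isT raI (sep_fstr _ _).
have raX : nth [::] ra X = [::] by rewrite /ra nth_set_nth.
rewrite raX cats0 size_fstr in r2.
set rb := set_nth _ _ _ _ in r2.
have r3 := run_store_entry rb t dX.
have rbX : nth [::] rb X = rev (fstr (body x)) by rewrite /rb nth_set_nth.
have rbd : nth [::] rb dst = lstr L.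
  by rewrite /rb nth_set_nth /= dXn nth_set_nth /= dIn /ra nth_set_nth /= dIn.
rewrite rbX rbd revK -lstr_cons size_rev size_fstr in r3.
set rc := set_nth _ _ _ _ in r3.
have rcE a : nth [::] rc a = if a == dst then lstr (body x :: L) else
    if a == 0 then [::] else if a == 7 then z1 else nth [::] r a.
  rewrite /rc nth_set_nth /=; case: eqP => // _.
  rewrite nth_set_nth /=; case: eqP => // /eqP/negbTE a0.
  by rewrite /rb nth_set_nth /= a0 nth_set_nth /= /ra nth_set_nth /=; case: eqP.
have r4 : runs _ (memory rc t) _ _ := IH (body x :: L) rc _ _ _ _.
rewrite !rcE Xd Id eqxx /= in r4.
have := runs_while_loop p (runs_seq r1 (runs_seq r2 r3))
  (r4 erefl erefl erefl (fun y hy => sN y (mem_behead (s := x :: items) hy))).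
rewrite rev_cons cat_rcons.
have Em w : memory (set_nth [::] (set_nth [::] rc 7 (Sy M sBar :: z)) dst w) t =
    memory (set_nth [::] (set_nth [::] r In (Sy M sBar :: z)) dst w) t.
  apply: memory_nth => a; rewrite !nth_set_nth /=.
  have [//|ad] := boolP (a == dst :> nat); rewrite !nth_set_nth /=.
  have [//|a7] := boolP (a == 7); rewrite rcE (negbTE ad) (negbTE a7).
  by case: eqP => [->|].
rewrite Em => H; apply: runs_weaken H _.
have le : Tskip * (size (pre x)).+1 <= Tskip * N.+1.
  by rewrite leq_mul2l ltnS (leq_trans (leq_addr _ _) sx') orbT.
have fN : fsize (body x) <= N := leq_trans (leqnSn _) (leq_trans (leq_addl _ _) sx').
rewrite /= mulSn.
move: (size items * _) => a; rewrite mulnDl.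
move: (Tskip * _) (Tskip * _) le => b c le; lia.
Qed.
End Load.

Lemma runs_no_skip (x : formula) r t z : nth [::] r In = str [::] ++ z ->
  runs Skip (memory r t) (2 * (size (@nil symbol)).+1) (memory (set_nth [::] r In z) t).
Proof.
move=> E; rewrite (@memory_nth M (set_nth [::] r In z) r).
  by apply: runs_weaken (runs_skip _) _.
by move=> a; rewrite nth_set_nth /=; case: eqP => // ->.
Qed.

Definition default_head f : seq symbol :=
  sTop :: sColon :: rcons (enc_formula f) sComma ++ [:: sSlash].

Lemma default_itemE f :
  item default_head id f = rcons (enc_default (normal_default f)) sSep.
Proof. by rewrite /item /= cats0 rcons_cat /= -catA. Qed.

Lemma no_separator c f : c \in [:: sColon; sComma; sSlash; sHigher; sSep; sBar] ->
  c \notin enc_formula f.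
Proof. by move=> cs; apply/negP => /enc_formula_sep; rewrite cs. Qed.

Lemma run_skip_default f r t z : nth [::] r In = str (default_head f) ++ z ->
  runs (skip_to sSlash) (memory r t) (2 * (size (default_head f)).+1)
    (memory (set_nth [::] r In z) t).
Proof.
move=> E; have cw : sSlash \notin sTop :: sColon :: rcons (enc_formula f) sComma.
  by rewrite !inE mem_rcons inE /= no_separator.
have := @run_skip_to sSlash _ z r t cw; rewrite E /str /default_head.
rewrite -!cat_cons map_cat -catA => /(_ erefl) H; apply: runs_weaken H _.
rewrite /= !size_cat /=; lia.
Qed.

Definition pair_head (p : formula * formula) : seq symbol :=
  enc_default (normal_default p.1) ++ sHigher :: default_head p.2.

Definition normal_pair (p : formula * formula) :=
  (normal_default p.1, normal_default p.2).

Lemma pair_itemE p : item pair_head snd p = rcons (enc_pair (normal_pair p)) sSep.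
Proof.
rewrite /item /pair_head -catA cat_cons -[_ ++ rcons _ _]/(item default_head id p.2).
by rewrite default_itemE /enc_pair rcons_cat.
Qed.

Lemma run_skip_pair p r t z : nth [::] r In = str (pair_head p) ++ z ->
  runs (Seq (skip_to sHigher) (skip_to sSlash)) (memory r t)
    (2 * (size (pair_head p)).+1) (memory (set_nth [::] r In z) t).
Proof.
move=> E; have cw : sHigher \notin enc_default (normal_default p.1).
  rewrite /enc_default /= cats0 !(inE, mem_cat, mem_rcons) /=.
  by rewrite !(negbTE (no_separator _ _)).
have E1 : nth [::] r In = str (enc_default (normal_default p.1)) ++
    Sy M sHigher :: str (default_head p.2) ++ z by rewrite E /str map_cat -catA.
have r1 := run_skip_to t cw E1.
set r' := set_nth _ _ _ _ in r1.
have E2 : nth [::] r' In = str (default_head p.2) ++ z by rewrite nth_set_nth.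
have r2 := run_skip_default t E2; rewrite set_set_nth eqxx in r2.
have := runs_seq r1 r2 => H; apply: runs_weaken H _.
have -> : size (pair_head p) =
    size (enc_default (normal_default p.1)) + (size (default_head p.2)).+1.
  by rewrite size_cat.
move: (size (enc_default _)) (size (default_head _)) => a b; lia.
Qed.

(** The lone [Pop] strips [sNeg] from the code of [Neg phi]; the last call tests [phi] itself with
    the final list. A failed test leaves the verdict register empty, which is how [program_machine]
    accepts. *)
Definition main : Cmd :=
  Seq (load (skip_to sSlash) A)
 (Seq (load Skip Cu)
 (Seq (load (Seq (skip_to sHigher) (skip_to sSlash)) S)
 (Seq (Pop (Rg In))
 (Seq (greedy_loop M)
 (Seq (move_all (Rg In) (Rg X))
 (Seq (remove M Cu)
 (Seq (store_entry M X Cu) (sat_call M)))))))).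

Definition main_input (fs W : seq formula) (ord : seq (formula * formula)) phi :=
  enc_list enc_default (map normal_default fs) ++ sBar ::
  enc_list enc_formula W ++ sBar ::
  enc_list enc_pair (map normal_pair ord) ++ sBar ::
  enc_formula (Neg phi).

(** 12 is the 10 of [run_load] plus the factor 2 common to the three skipping programs. *)
Definition load_time N := (N * (12 * N.+1 + 6)).+2.

(** The arguments [2 * N] of [remove_time] and [sat_time] account for the query joining a list of
    length up to [N]. *)
Definition main_time N T :=
  load_time N + (load_time N + (load_time N + (1 + ((2 * N * (pass_time M N T).+1).+1 +
    ((N * 5).+1 + (remove_time (2 * N) + ((2 * N) * 5 + 3 + sat_time M (2 * N) T))))))).

Lemma size_flatten_mem (U : eqType) (h : U -> seq symbol) (s : seq U) x : x \in s ->
  size (h x) <= size (flatten (map h s)).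
Proof.
elim: s => // y s IH; rewrite inE /= size_cat => /predU1P[->|/IH]; first exact: leq_addr.
by move=> le; apply: leq_trans le (leq_addl _ _).
Qed.

Lemma size_flatten_ge (U : eqType) (h : U -> seq symbol) (s : seq U) :
  (forall x, 0 < size (h x)) -> size s <= size (flatten (map h s)).
Proof.
move=> h0; elim: s => //= y s IH; rewrite size_cat -add1n.
by apply: leq_add.
Qed.

Lemma load_bound (U : eqType) pre body (s : seq U) N :
  size (flatten (map (item pre body) s)) <= N ->
  (forall x, x \in s -> size (item pre body x) <= N) /\
  (size s * ((2 + 10) * N.+1 + 6)).+2 <= load_time N.
Proof.
move=> le; split=> [x xs|]; first exact: leq_trans (size_flatten_mem _ xs) le.
rewrite /load_time !ltnS leq_mul // (leq_trans _ le) // size_flatten_ge // => x.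
by rewrite size_cat size_rcons addnS.
Qed.

Lemma main_inputE fs W ord phi : main_input fs W ord phi =
  flatten (map (item default_head id) fs) ++ sBar ::
  flatten (map (item (fun=> [::]) id) W) ++ sBar ::
  flatten (map (item pair_head snd) ord) ++ sBar ::
  enc_formula (Neg phi).
Proof.
rewrite /main_input /enc_list -!map_comp; congr (flatten _ ++ _).
  by apply: eq_map => f; rewrite /= default_itemE.
by congr (_ :: _ ++ _ :: flatten _ ++ _); apply: eq_map => p; rewrite /= pair_itemE.
Qed.

Lemma lsize_items (U : eqType) pre body (s : seq U) :
  lsize (map body s) <= size (flatten (map (item pre body) s)).
Proof.
elim: s => //= x s IH; rewrite lsize_cons !size_cat size_rcons /fsize.
move: IH; move: (size _) (size _) (lsize _) (size _) => a b c d; lia.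
Qed.

Lemma lsize_rev L : lsize (rev L) = lsize L.
Proof. by apply: lsize_perm; rewrite perm_rev. Qed.

Lemma run_main fs W (ord : seq (formula * formula)) phi N T :
  let rank f := count_mem f (map snd ord) in
  let prec := fun g f => (g, f) \in ord in
  uniq fs -> uniq W ->
  (forall g f, prec g f -> rank g < rank f) ->
  (forall g f, g \in fs -> f \in fs -> g != f -> prec g f || prec f g) ->
  size (main_input fs W ord phi) <= N ->
  (forall L, uniq L -> {subset L <= phi :: W ++ fs} -> lsize L <= 2 * N ->
     exists v, tm_halts_within M (enc_list enc_formula L) T v /\
               (v <-> satisfiable [set` L])) ->
  exists acc (v : bool) s,
    [/\ {subset acc <= fs},
      forall f, f \in fs -> f \notin acc ->
        ~ satisfiable (f |` [set` W] `|` [set g | g \in acc /\ prec g f]),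
      satisfiable [set` W] -> satisfiable [set` W ++ acc] &
      v <-> satisfiable [set` phi :: W ++ acc]] /\
    runs main (input_store (Sy M) (Rg In) (main_input fs W ord phi)) (main_time N T) s /\
    (s (Rg Re) == [::]) = ~~ v.
Proof.
move=> rank prec Ufs UW prec_rank prec_total sN dec.
set D := flatten (map (item default_head id) fs).
set F := flatten (map (item (fun=> [::]) id) W).
set O := flatten (map (item pair_head snd) ord).
have [DFN FN ON phiN] : [/\ size D + size F <= N, size F <= N, size O <= N & fsize phi < N].
  move: sN; rewrite main_inputE -/D -/F -/O; do 3!rewrite size_cat /=.
  rewrite -/(fsize phi).
  by move: (size D) (size F) (size O) => a b c; split; lia.
pose r0 inp a s c : seq (seq G) :=
  [:: [::]; [::]; [::]; [::]; [::]; [::]; [::]; inp; a; [::]; s; c; [::]; [::]].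
have E0 : input_store (Sy M) (Rg In) (main_input fs W ord phi) =
    memory (r0 (str (main_input fs W ord phi)) [::] [::] [::]) blank_tapes.
  apply/funext=> -[[k kl]|[i b]]; rewrite /input_store; last first.
    by case: eqP => // _; case: b.
  by rewrite (inj_eq (@inl_inj _ _)) -val_eqE /=; do 14!(case: k kl => [|k] kl //=).
pose z2 := str (enc_formula (Neg phi)).
pose z1 := str O ++ Sy M sBar :: z2.
pose z0 := str F ++ Sy M sBar :: z1.
have Ein : str (main_input fs W ord phi) = str D ++ Sy M sBar :: z0.
  by rewrite main_inputE -/D -/F -/O /z0 /z1 /str !map_cat /= !map_cat /= map_cat.
have DN : size D <= N := leq_trans (leq_addr _ _) DFN.
have [sD tD] := load_bound DN.
have [sF tF] := load_bound FN.
have [sO tO] := load_bound ON.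
have preD f : sBar \notin default_head f.
  by rewrite /default_head !(inE, mem_cat, mem_rcons) /= (negbTE (no_separator _ _)).
have preO p : sBar \notin pair_head p.
  rewrite /pair_head /default_head /enc_default /= cats0.
  by rewrite !(inE, mem_cat, mem_rcons) /= !(negbTE (no_separator _ _)).
have r1 := runs_weaken (@run_load _ default_head id (skip_to sSlash) 2 run_skip_default
  preD A fs [::] z0 (r0 (str (main_input fs W ord phi)) [::] [::] [::]) blank_tapes N
  isT isT erefl erefl Ein sD) tD.
rewrite map_id cats0 /= in r1.
have r2 := runs_weaken (@run_load _ (fun=> [::]) id Skip 2 runs_no_skip
  (fun _ => isT) Cu W [::] z1 (r0 z0 (lstr (rev fs)) [::] [::]) blank_tapes N
  isT isT erefl erefl erefl sF) tF.
rewrite map_id cats0 /= in r2.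
have r3 := runs_weaken (@run_load _ pair_head snd _ 2 run_skip_pair
  preO S ord [::] z2 (r0 z1 (lstr (rev fs)) [::] (lstr (rev W))) blank_tapes N
  isT isT erefl erefl erefl sO) tO.
rewrite cats0 /= in r3.
have r4 := @run_pop M In (r0 z2 (lstr (rev fs)) (lstr (rev (map snd ord))) (lstr (rev W)))
  blank_tapes.
rewrite /= in r4.
have decN L : uniq L -> {subset L <= rev W ++ rev fs} -> lsize L <= N ->
    exists v, tm_halts_within M (enc_list enc_formula L) T v /\
              (v <-> satisfiable [set` L]).
  move=> UL sub LN; apply: dec => // [f /sub|]; last by lia.
  by rewrite inE !mem_cat !mem_rev => ->; rewrite orbT.
have Ufs' : uniq (rev fs) by rewrite rev_uniq.
have prec_total' g f : g \in rev fs -> f \in rev fs -> g != f -> prec g f || prec f g.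
  by rewrite !mem_rev; apply: prec_total.
have rankE : {in rev fs, forall f, count_mem f (rev (map snd ord)) = rank f}.
  by move=> f _; rewrite count_rev.
have lD : lsize fs <= size D by have := lsize_items default_head id fs; rewrite map_id.
have lF : lsize W <= size F by have := lsize_items (fun=> [::]) id W; rewrite map_id.
have lO : lsize (map snd ord) <= size O by exact: lsize_items.
have UW' : uniq (rev W) by rewrite rev_uniq.
have sWfs : lsize (rev W) + lsize (rev fs) <= N by rewrite !lsize_rev; lia.
have sLs : lsize (rev (map snd ord)) <= N by rewrite lsize_rev; lia.
have [acc [cur [[as_ Ucur curE rej sat] [curN [s r5]]]]] :=
  run_greedy_loop Ufs' prec_rank prec_total' decN (fstr phi) rankE UW' sWfs sLs.
have r6 := @run_move_all M In X [:: [::]; [::]; [::]; [::]; [::]; [::]; [::]; fstr phi;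
  [::]; [::]; s; lstr cur; [::]; [::]] blank_tapes isT.
rewrite /= cats0 size_fstr in r6.
have phi2N : fsize phi <= 2 * N by lia.
have cur2N : lsize cur <= 2 * N by lia.
have r7 := @run_remove M Cu 4 erefl phi cur (2 * N) [:: [::]; [::]; [::]; s; lstr cur;
  [::]; [::]] blank_tapes phi2N cur2N erefl.
rewrite /= in r7.
have r8 := @run_store_entry M X Cu [:: rev (fstr phi); [::]; [::]; [::]; [::]; [::];
  mark M (phi \in cur); [::]; [::]; [::]; s; lstr (rem phi cur); [::]; [::]]
  blank_tapes isT.
rewrite /= revK -lstr_cons size_rev size_fstr in r8.
have new2N : lsize (phi :: rem phi cur) <= 2 * N.
  by rewrite lsize_cons; have := lsize_rem phi cur; lia.
have newE : phi :: rem phi cur =i phi :: W ++ acc.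
  move=> f; rewrite !inE mem_rem_uniq // inE curE !mem_cat mem_rev.
  by case: eqP.
have [v [Hv vE]] : exists v,
    tm_halts_within M (enc_list enc_formula (phi :: rem phi cur)) T v /\
    (v <-> satisfiable [set` phi :: rem phi cur]).
  apply: dec => //; first by rewrite /= mem_rem_uniq // inE eqxx rem_uniq.
  move=> f; rewrite newE !inE !mem_cat => /or3P[->//|->|/as_]; rewrite ?orbT //.
  by rewrite mem_rev => ->; rewrite !orbT.
have r9 := run_sat_call [::] (mark M (phi \in cur)) [::] [::] [::] s new2N Hv.
have setE (L L' : seq formula) : L =i L' -> [set` L] = [set` L'] :> set formula.
  by move=> E; apply/seteqP; split=> f /=; rewrite E.
exists acc, v, (state [::] (mark M (phi \in cur)) [::] [::] [::] s
  (lstr (phi :: rem phi cur)) (if v then [:: Sy M sTop] else [::])).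
have revWE : rev W ++ acc =i W ++ acc by move=> f; rewrite !mem_cat mem_rev.
rewrite (setE _ _ newE) in vE.
rewrite (setE _ _ revWE) (setE _ _ (mem_rev W)) in sat.
rewrite (setE _ _ (mem_rev W)) in rej.
split; last split; last by case: (v).
  split=> // f; first by move=> /as_; rewrite mem_rev.
  by rewrite -mem_rev; apply: rej.
rewrite E0; apply: runs_weaken (runs_seq r1 (runs_seq r2 (runs_seq r3 (runs_seq r4
  (runs_seq r5 (runs_seq r6 (runs_seq r7 (runs_seq r8 r9)))))))) _.
rewrite /main_time !leq_add2l leq_add //; last by rewrite leq_add2l leq_add2r; lia.
by rewrite ltnS leq_mul2r ltnW.
Qed.

End Main.

(** * Polynomial time *)

Section PolynomialBounds.

(** With coefficients in [nat] every term is monotone, so a time bound may be evaluated at any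
    overestimate of the size. *)
Lemma horner_nat_mono (p : {poly nat}) m n : m <= n -> p.[m]%R <= p.[n]%R.
Proof.
move=> mn; rewrite !horner_coef; apply: leq_sum => i _.
by apply: leq_mul => //; elim: (i : nat) => // j IH; rewrite !GRing.exprS; apply: leq_mul.
Qed.

Definition poly_bounded (h : nat -> nat) : Prop :=
  exists q : {poly nat}, forall n, h n <= q.[n]%R.

Lemma poly_bounded_le h h' : (forall n, h n <= h' n) ->
  poly_bounded h' -> poly_bounded h.
Proof. by move=> le [q Hq]; exists q => n; apply: leq_trans (le n) (Hq n). Qed.

Lemma poly_bounded_cst c : poly_bounded (fun=> c).
Proof. by exists (c%:P)%R => n; rewrite hornerC. Qed.

Lemma poly_bounded_id : poly_bounded id.
Proof. by exists 'X%R => n; rewrite hornerX. Qed.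

Lemma poly_bounded_add h h' : poly_bounded h -> poly_bounded h' ->
  poly_bounded (fun n => h n + h' n).
Proof.
move=> [q Hq] [q' Hq']; exists (q + q')%R => n; rewrite hornerD.
exact: leq_add (Hq n) (Hq' n).
Qed.

Lemma poly_bounded_mul h h' : poly_bounded h -> poly_bounded h' ->
  poly_bounded (fun n => h n * h' n).
Proof.
move=> [q Hq] [q' Hq']; exists (q * q')%R => n; rewrite hornerM.
exact: leq_mul (Hq n) (Hq' n).
Qed.

Lemma poly_bounded_horner (p : {poly nat}) h : poly_bounded h ->
  poly_bounded (fun n => p.[h n]%R).
Proof.
move=> [q Hq]; exists (p \Po q)%R => n; rewrite horner_comp.
exact: horner_nat_mono (Hq n).
Qed.

Lemma poly_bounded_succ h : poly_bounded h -> poly_bounded (fun n => (h n).+1).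
Proof.
move=> H; apply: poly_bounded_le (poly_bounded_add (poly_bounded_cst 1) H) => n.
by rewrite add1n.
Qed.

Lemma poly_bounded_double h : poly_bounded h -> poly_bounded (fun n => (h n).*2).
Proof.
move=> H; apply: poly_bounded_le (poly_bounded_add H H) => n.
by rewrite addnn.
Qed.

End PolynomialBounds.

Ltac poly_bound :=
  repeat first
    [ assumption | exact: poly_bounded_cst | exact: poly_bounded_id
    | apply: poly_bounded_add | apply: poly_bounded_succ | apply: poly_bounded_double
    | apply: poly_bounded_mul | apply: poly_bounded_horner ].

Lemma main_time_poly (M : turing_machine symbol) (p : {poly nat}) :
  poly_bounded (fun n => main_time M n p.[2 * n]%R).
Proof.
rewrite /main_time /load_time /pass_time /examine_time /process_time /sat_time
  /remove_time /machine_time.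
poly_bound.
Qed.

(** * Length of the encoded instance *)

Lemma set_size_uniq {T : eqType} (enc : T -> seq symbol) (s : seq T) : uniq s ->
  set_size enc s = \sum_(x <- s) size (enc x).
Proof. by move=> Us; rewrite /set_size undup_id. Qed.

Lemma size_enc_list {T : Type} (enc : T -> seq symbol) (s : seq T) :
  size (enc_list enc s) = \sum_(x <- s) (size (enc x)).+1.
Proof.
rewrite /enc_list size_flatten sumnE !big_map.
by apply: eq_bigr => x _; rewrite size_rcons.
Qed.

Lemma set_size_sub {T : eqType} (enc : T -> seq symbol) (s s' : seq T) :
  uniq s -> {subset s <= s'} -> \sum_(x <- s) size (enc x) <= set_size enc s'.
Proof.
move=> Us sub; apply: (@leq_trans (\sum_(x <- undup s' | x \in s) size (enc x))).
  rewrite -[leqRHS]big_filter leq_eqVlt; apply/orP; left; apply/eqP/perm_big.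
  apply: uniq_perm; rewrite ?filter_uniq ?undup_uniq // => x.
  by rewrite mem_filter mem_undup; case: (boolP (x \in s)) => // /sub ->.
by rewrite /set_size [leqRHS](bigID (mem s)) leq_addr.
Qed.

Lemma size_enc_list_le {T : eqType} (enc : T -> seq symbol) (s : seq T) :
  (forall x, 0 < size (enc x)) ->
  size (enc_list enc s) <= 2 * \sum_(x <- s) size (enc x).
Proof.
move=> enc0; rewrite size_enc_list big_distrr /=; apply: leq_sum => x _.
by have := enc0 x; lia.
Qed.

Lemma enc_formula_gt0 f : 0 < size (enc_formula f).
Proof. by case: f. Qed.

Lemma enc_default_gt0 d : 0 < size (enc_default d).
Proof. by rewrite /enc_default !size_cat /=; lia. Qed.

(** [2 * n] covers the defaults and again the facts, with a separator each. There are at most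
    [n * n] distinct pairs, each of length at most [2 * n + 2] with its separator; the query adds
    [n] and the bars 3. *)
Definition input_bound n := 2 * n + (2 * n + (n * n * (2 * n + 2) + n + 1) + 1) + 1.

Lemma size_enc_instance x : uniq (inst_defaults x) -> uniq (inst_facts x) ->
  uniq (inst_order x) ->
  (forall p, p \in inst_order x -> p.1 \in inst_defaults x /\ p.2 \in inst_defaults x) ->
  size (enc_instance x) <= input_bound (inst_size x).
Proof.
move=> UD UW UO OD; rewrite /input_bound; set n := inst_size x.
have nE : n = \sum_(d <- inst_defaults x) size (enc_default d) +
    set_size enc_formula (Neg (inst_query x) :: inst_facts x).
  by rewrite /n /inst_size set_size_uniq.
have Dn d : d \in inst_defaults x -> size (enc_default d) <= n.
  move=> dD; rewrite nE (big_rem d dD) /=; lia.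
have DN : size (inst_defaults x) <= n.
  rewrite nE; apply: leq_trans (leq_addr _ _).
  by rewrite -sum1_size; apply: leq_sum => d _; apply: enc_default_gt0.
have ON : size (inst_order x) <= n * n.
  apply: leq_trans (leq_mul DN DN).
  rewrite -(size_allpairs pair); apply: uniq_leq_size => // -[d e] /OD[/= dD eD].
  by apply: allpairs_f.
have phin : size (enc_formula (Neg (inst_query x))) <= n.
  rewrite nE; apply: leq_trans (leq_addl _ _).
  have := @set_size_sub _ enc_formula [:: Neg (inst_query x)]
    (Neg (inst_query x) :: inst_facts x) isT.
  rewrite big_seq1; apply => y; rewrite inE => /eqP ->; exact: mem_head.
have Wn : \sum_(f <- inst_facts x) size (enc_formula f) <= n.
  rewrite nE; apply: leq_trans (leq_addl _ _).
  by apply: set_size_sub => // f fW; rewrite inE fW orbT.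
have LW := size_enc_list_le (inst_facts x) enc_formula_gt0.
have LD := size_enc_list_le (inst_defaults x) enc_default_gt0.
have LO : size (enc_list enc_pair (inst_order x)) <= n * n * (2 * n + 2).
  rewrite size_enc_list.
  apply: (@leq_trans (\sum_(p <- inst_order x) (2 * n + 2))); last first.
    by rewrite big_const_seq count_predT iter_addn_0 mulnC leq_mul2r ON orbT.
  rewrite big_seq [leqRHS]big_seq; apply: leq_sum => p /OD[/Dn d1 /Dn d2].
  have -> : size (enc_pair p) = size (enc_default p.1) + (size (enc_default p.2)).+1.
    by rewrite size_cat.
  lia.
have {}LD : size (enc_list enc_default (inst_defaults x)) <= 2 * n.
  by apply: leq_trans LD _; rewrite leq_mul2l nE leq_addr.
have {}LW : size (enc_list enc_formula (inst_facts x)) <= 2 * n.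
  by apply: leq_trans LW _; rewrite leq_mul2l Wn.
rewrite /enc_instance; do 3!rewrite size_cat [size (_ :: _)]/=.
rewrite [size (enc_formula (Neg _))]/= in phin.
move: LD LW LO phin.
move: (size _) (size _) (size _) (size _) (n * n * _) => a b c d e; lia.
Qed.

(** [lsize] also counts separators, so it exceeds the size in which the time is given, and
    monotonicity gives one time bound for all lists up to length [N]. *)
Lemma satisfiability_machine (M : turing_machine symbol) (p : {poly nat})
    (F : set formula) (N : nat) :
  (forall S, [set S : seq formula | uniq S /\ [set` S] `<=` F] S ->
    exists2 b : bool,
      tm_halts_within M (enc_list enc_formula S) p.[set_size enc_formula S]%R b &
      (b <-> satisfiable [set` S])) ->
  forall L, uniq L -> [set` L] `<=` F -> lsize L <= N ->
  exists v, tm_halts_within M (enc_list enc_formula L) p.[N]%R v /\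
            (v <-> satisfiable [set` L]).
Proof.
move=> dec L UL LF LN; have [v [n le Hn] vE] := dec L (conj UL LF).
exists v; split=> //; exists n => //; apply: leq_trans le _; apply: horner_nat_mono.
rewrite set_size_uniq // (leq_trans _ LN) // /lsize size_enc_list.
by apply: leq_sum => f _.
Qed.

Theorem theorem5p21 (F : set formula) (C : set default_theory) :
  poly_time_satisfiability F ->
  (forall Delta : default_theory, C Delta ->
    (exists F0 : set formula,
      [/\ finite_set F0, F0 `<=` F &
          defaults Delta = [set normal_default f | f in F0]]) /\
    finite_set (facts Delta) /\ facts Delta `<=` F) ->
  poly_time_preferred_L F C.
Proof.
move=> [M [p dec]] HC.
have [q Hq] : poly_bounded (fun n =>
    (main_time M (input_bound n) p.[2 * input_bound n]%R).+1).
  have [q Hq] := main_time_poly M p.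
  apply: (@poly_bounded_le _ (fun n => (q.[input_bound n]%R).+1)) => [n|].
    by rewrite ltnS.
  by rewrite /input_bound; poly_bound.
exists (program_machine (Sy M) (inl (@Ordinal 14 7 isT)) (inl (@Ordinal 14 13 isT))
          (main M)), q.
move=> x [[UD UW UO] [Cx Px Fphi]].
have [[F0 [_ F0F /= DE]] [_ /= WF]] := HC _ Cx.
(* A default [: f / f] is recovered from its conclusion, which presents the abstract set [F0] as a
   list. *)
pose fs := map conclusion (inst_defaults x).
have Dfs : inst_defaults x = map normal_default fs.
  rewrite -map_comp map_id_in // => d dD /=.
  have : [set` inst_defaults x] d by [].
  by rewrite DE => -[f _ <-].
have fsF : [set` fs] `<=` F.
  move=> f /= ffs; apply: F0F.
  have : [set` inst_defaults x] (normal_default f) by rewrite Dfs /=; apply: map_f.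
  by rewrite DE => -[g gF /normal_default_inj <-].
have Ufs : uniq fs by move: UD; rewrite Dfs (map_inj_uniq normal_default_inj).
have [[PD Ptrans Pasym] Ptot] := Px.
pose ord := map (fun p => (conclusion p.1, conclusion p.2)) (inst_order x).
have Odef pr : pr \in inst_order x -> pr.1 \in inst_defaults x /\ pr.2 \in inst_defaults x.
  by case: pr => d e /PD.
have ordE : inst_order x = map (@normal_pair) ord.
  rewrite -map_comp map_id_in // => -[d e] /Odef[] /=; rewrite Dfs.
  by move=> /mapP[g _ ->] /mapP[f _ ->].
have mem_ord g f : ((g, f) \in ord) =
    ((normal_default g, normal_default f) \in inst_order x).
  rewrite ordE -[in RHS]/(normal_pair (g, f)) mem_map //.
  move=> [a b] [c d] E.
  have /= -> := congr1 (conclusion \o fst) E.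
  by have /= -> := congr1 (conclusion \o snd) E.
have Uord : uniq ord.
  by move: UO; rewrite ordE => /map_uniq.
(* Ranks count predecessors: those of [g], and [g] itself, all precede [f], and irreflexivity keeps
   [g] from being counted twice. *)
have rankP g f : (g, f) \in ord ->
    count_mem g (map snd ord) < count_mem f (map snd ord).
  move=> gf; pose preds h := map fst (filter (fun pr => pr.2 == h) ord).
  have predE h : count_mem h (map snd ord) = size (preds h).
    by rewrite size_map size_filter count_map.
  have mem_preds a h : (a \in preds h) = ((a, h) \in ord).
    apply/mapP/idP => [[[b c]]|ah]; last by exists (a, h); rewrite ?mem_filter //= eqxx.
    by rewrite mem_filter => /andP[/= /eqP -> bh] ->.
  have Upreds h : uniq (preds h).
    rewrite map_inj_in_uniq ?filter_uniq // => -[a b] [c d].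
    by rewrite !mem_filter => /andP[/= /eqP -> _] /andP[/= /eqP -> _] ->.
  rewrite !predE; apply: (@uniq_leq_size _ (g :: preds g)).
    rewrite /= Upreds andbT mem_preds mem_ord; apply/negP => gg.
    exact: (Pasym _ _ gg gg).
  move=> h; rewrite inE !mem_preds => /predU1P[->//|].
  by rewrite !mem_ord => hg; apply: Ptrans hg _; rewrite /inst_rel -mem_ord.
have totalP g f : g \in fs -> f \in fs -> g != f -> ((g, f) \in ord) || ((f, g) \in ord).
  move=> gfs ffs /eqP gf; rewrite !mem_ord; apply/orP.
  by apply: Ptot; rewrite /= ?Dfs ?map_f // => /normal_default_inj.
have inE_ : enc_instance x = main_input fs (inst_facts x) ord (inst_query x).
  by rewrite /main_input -Dfs -ordE.
pose N := input_bound (inst_size x).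
have sN : size (main_input fs (inst_facts x) ord (inst_query x)) <= N.
  by rewrite -inE_; apply: size_enc_instance.
(* All tested formulas lie in [F]: the query by assumption on the instance, facts and conclusions by
   the assumption on [C]. *)
have decN L : uniq L -> {subset L <= inst_query x :: inst_facts x ++ fs} ->
    lsize L <= 2 * N ->
    exists v, tm_halts_within M (enc_list enc_formula L) p.[2 * N]%R v /\
              (v <-> satisfiable [set` L]).
  move=> UL sub; apply: (satisfiability_machine dec) => // f /sub.
  by rewrite inE mem_cat => /or3P[/eqP->//|/WF//|/fsF].
have [acc [v [s [[as_ rej sat vE] [[t tle ex] sE]]]]] :=
  run_main Ufs UW rankP totalP sN decN.
(* The answer is yes exactly when the last test fails. *)
exists (~~ v).
  rewrite -sE inE_; have [n nle Hn] := program_machineP (inl (@Ordinal 14 13 isT)) ex.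
  by exists n => //; apply: leq_trans nle (leq_trans _ (Hq _)).
have -> : inst_theory x = normal_theory fs (inst_facts x).
  by rewrite /inst_theory Dfs.
have rej' f : f \in fs -> f \notin acc -> ~ satisfiable (f |` [set` inst_facts x] `|`
    [set g | g \in acc /\ inst_rel x (normal_default g) (normal_default f)]).
  move=> ffs facc; have := rej f ffs facc; congr (~ satisfiable (_ `|` _)).
  by apply/seteqP; split=> g /=; rewrite mem_ord.
rewrite Dfs in Px.
have rankP' f g : inst_rel x (normal_default g) (normal_default f) ->
    count_mem g (map snd ord) < count_mem f (map snd ord).
  by move=> gf; apply: rankP; rewrite mem_ord.
rewrite /= (entails_L_greedy Px rankP' as_ sat rej').
have -> : inst_query x |` [set` inst_facts x ++ acc] =
    [set` inst_query x :: inst_facts x ++ acc].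
  apply/seteqP; split=> f /=; rewrite inE; first by case=> [->|->]; rewrite ?eqxx ?orbT.
  by move=> /predU1P[->|]; [left|right].
split=> [/negP nv /vE//|H].
by apply/negP => /vE.
Qed.
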